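(* Let a map $F \colon \mathbb{R}^d \to \mathbb{S}^{\ell}$ be convex, with components $F_{ij}$. Then for all $i, j \in \{1, \ldots, \ell\}$, $i \ne j$, the function $F_{ij} \colon \mathbb{R}^d \to \mathbb{R}$ is DC (i.e. a difference of two finite-valued convex functions on $\mathbb{R}^d$) and, therefore, Lipschitz continuous on any bounded set and twice differentiable almost everywhere.
   Context: $\mathbb{S}^{\ell}$ is the space of real symmetric matrices of order $\ell$, with the Löwner partial order: $A \preceq B$ iff $B - A$ is positive semidefinite. A map $F \colon \mathbb{R}^d \to \mathbb{S}^{\ell}$ is called convex if $F(\alpha x_1 + (1-\alpha) x_2) \preceq \alpha F(x_1) + (1 - \alpha) F(x_2)$ for all $x_1, x_2 \in \mathbb{R}^d$, $\alpha \in [0,1]$. ''Twice differentiable almost everywhere'' is understood in the sense of the Busemann–Feller–Aleksandrov theorem on convex functions: at almost every point (Lebesgue measure) the function admits a second-order Taylor expansion with remainder $o(|\cdot|^2)$. *)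

(* Defs.v *)
From HB Require Import structures.
From mathcomp Require Import all_boot all_order all_algebra.
From mathcomp Require Import sesquilinear.
From mathcomp Require Import all_classical all_reals all_analysis.

Set Implicit Arguments.
Unset Strict Implicit.
Unset Printing Implicit Defensive.

Import Order.TTheory GRing.Theory Num.Theory.
Import numFieldNormedType.Exports.

Local Open Scope classical_set_scope.
Local Open Scope ring_scope.

(* R^d is 'rV[R]_d; its library norm is the sup norm, which is equivalent to
   the Euclidean one, so boundedness, Lipschitz continuity and o(|h|^2) are the
   usual notions. *)

Section Loewner.
Context {R : realType} {l : nat}.
Implicit Types A B M : 'M[R]_l.

Definition psdmx M : Prop :=
  M \is symmetricmx /\ forall v : 'rV[R]_l, 0 <= (v *m M *m v^T) ord0 ord0.

Definition loewner_le A B : Prop := psdmx (B - A).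

End Loewner.

Definition mx_convex {R : realType} {d l : nat} (F : 'rV[R]_d -> 'M[R]_l) : Prop :=
  forall (x1 x2 : 'rV[R]_d) (alpha : R), 0 <= alpha <= 1 ->
    loewner_le (F (alpha *: x1 + (1 - alpha) *: x2))
               (alpha *: F x1 + (1 - alpha) *: F x2).

Definition is_DC {R : realType} {d : nat} (f : 'rV[R]_d -> R) : Prop :=
  exists g h : 'rV[R]_d -> R,
    [/\ convex_function [set: 'rV[R]_d] g,
        convex_function [set: 'rV[R]_d] h
      & forall x, f x = g x - h x].

(* Twice differentiability at x in the sense of Busemann-Feller-Aleksandrov:
   f(x + h) = f(x) + <p, h> + 1/2 <H h, h> + o(|h|^2) as h -> 0. No derivative
   of f is assumed to exist near x. *)
Definition twice_differentiable_at {R : realType} {d : nat}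
    (f : 'rV[R]_d -> R) (x : 'rV[R]_d) : Prop :=
  exists (p : 'rV[R]_d) (H : 'M[R]_d),
    H \is symmetricmx /\
    (fun h : 'rV[R]_d =>
       f (x + h) - (f x + (p *m h^T) ord0 ord0
                    + 2^-1 * (h *m H *m h^T) ord0 ord0) : R^o)
      =o_ (0 : 'rV[R]_d) (fun h : 'rV[R]_d => `|h| ^+ 2 : R^o).

Section LebesgueMeasure.
Context {R : realType} {d : nat}.
Implicit Types (a b : 'rV[R]_d) (A B : set 'rV[R]_d).
Implicit Type S : set ('rV[R]_d * 'rV[R]_d).

Definition box (ab : 'rV[R]_d * 'rV[R]_d) : set 'rV[R]_d :=
  [set x | forall i, x ord0 i \in `[ab.1 ord0 i, ab.2 ord0 i]].

Definition box_volume (ab : 'rV[R]_d * 'rV[R]_d) : R :=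
  \prod_(i < d) Num.max 0 (ab.2 ord0 i - ab.1 ord0 i).

(* Covers are countable sets of boxes rather than sequences: in dimension 0
   every box is the whole space and has volume 1, so the empty set must be
   covered by no box at all. *)
Definition box_cover A S : Prop :=
  countable S /\ A `<=` \bigcup_(ab in S) box ab.

Local Open Scope ereal_scope.

Definition lebesgue_outer A : \bar R :=
  ereal_inf [set \esum_(ab in S) (box_volume ab)%:E | S in box_cover A].

Let vol_ge0 ab : 0 <= (box_volume ab)%:E.
Proof. by rewrite lee_fin; apply: prodr_ge0 => i _; rewrite le_max lexx. Qed.

Lemma lebesgue_outer_ge0 A : 0 <= lebesgue_outer A.
Proof. by apply: le_ereal_inf_tmp => _ [S _ <-]; exact: esum_ge0. Qed.

Lemma lebesgue_outer0 : lebesgue_outer set0 = 0.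
Proof.
apply/eqP; rewrite eq_le lebesgue_outer_ge0 andbT.
apply: ereal_inf_lbound; exists set0; last by rewrite esum_set0.
by split.
Qed.

Lemma le_lebesgue_outer : {homo lebesgue_outer : A B / A `<=` B >-> A <= B}.
Proof.
move=> A B AB; apply/ereal_inf_le_tmp => _ [S [cS BS] <-].
by exists S => //; split => //; exact: subset_trans BS.
Qed.

Let esum_bigcup_le (S : (set ('rV[R]_d * 'rV[R]_d))^nat) :
  \esum_(ab in \bigcup_n S n) (box_volume ab)%:E <=
  \sum_(n <oo) \esum_(ab in S n) (box_volume ab)%:E.
Proof.
rewrite seqDU_bigcup_eq (esum_bigcupT _ _ (@trivIset_seqDU _ S) vol_ge0).
rewrite -nneseries_esumT; last by move=> n; exact: esum_ge0.
apply: lee_nneseries => n; first by move=> _ _; exact: esum_ge0.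
move=> _; rewrite esum_mkcond [leRHS]esum_mkcond.
apply: le_esum => ab _; case: ifPn => [|_]; last by case: ifP.
by rewrite inE => abS; rewrite mem_set//; exact: subset_seqDU abS.
Qed.

Lemma lebesgue_outer_sigma_subadditive : sigma_subadditive lebesgue_outer.
Proof.
move=> A; have [[i ioo]|] := pselect (exists i, lebesgue_outer (A i) = +oo).
  rewrite (eseries_pinfty _ _ ioo) ?leey// => n _.
  by rewrite -ltNye (lt_le_trans _ (lebesgue_outer_ge0 _)).
rewrite -forallNE => Aoo.
suff add2e (e : {posnum R}) : lebesgue_outer (\bigcup_n A n) <=
    \sum_(i <oo) lebesgue_outer (A i) + e%:num%:E.
  by apply/lee_addgt0Pr => _/posnumP[].
rewrite (le_trans _ (epsilon_trick _ _ _))//; last first.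
  by move=> n; exact: lebesgue_outer_ge0.
pose P n S := box_cover (A n) S /\ \esum_(ab in S) (box_volume ab)%:E <=
  lebesgue_outer (A n) + (e%:num / (2 ^ n.+1)%:R)%:E.
have [G PG] : {G : (set ('rV[R]_d * 'rV[R]_d))^nat & forall n, P n (G n)}.
  apply: (@choice _ _ P) => n.
  have fin : lebesgue_outer (A n) \is a fin_num.
    by rewrite ge0_fin_numE ?lebesgue_outer_ge0// ltey; apply/eqP.
  have en1 : (0 < e%:num / (2 ^ n.+1)%:R)%R by [].
  have [_ [S AS <-] Se] := lb_ereal_inf_adherent en1 fin.
  by exists S; split => //; exact/ltW.
apply: (@le_trans _ _ (\sum_(n <oo) \esum_(ab in G n) (box_volume ab)%:E)).
  apply: le_trans (esum_bigcup_le _); apply: ereal_inf_lbound.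
  exists (\bigcup_n G n) => //; split.
    by apply: bigcup_countable => // n _; exact: (PG n).1.1.
  move=> x [n _ /(PG n).1.2 [ab Gab xab]]; exists ab => //; by exists n.
apply: lee_nneseries => n; first by move=> _ _; exact: esum_ge0.
by move=> _; exact: (PG n).2.
Qed.

HB.instance Definition _ := isOuterMeasure.Build R 'rV[R]_d lebesgue_outer
  lebesgue_outer0 lebesgue_outer_ge0 le_lebesgue_outer
  lebesgue_outer_sigma_subadditive.

(* d-dimensional Lebesgue measure, on the Caratheodory (i.e. Lebesgue)
   measurable subsets of R^d. *)
Definition lebesgue_measure_rV : set (caratheodory_type lebesgue_outer) -> \bar R :=
  lebesgue_outer.

Let measure_rV0 : lebesgue_measure_rV set0 = 0.
Proof. exact: lebesgue_outer0. Qed.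

Let measure_rV_ge0 A : 0 <= lebesgue_measure_rV A.
Proof. exact: lebesgue_outer_ge0. Qed.

Let measure_rV_sigma_additive : semi_sigma_additive lebesgue_measure_rV.
Proof.
move=> A mA tA mUA; rewrite /lebesgue_measure_rV.
exact: caratheodory_measure_sigma_additive.
Qed.

HB.instance Definition _ := isMeasure.Build _ _ _ lebesgue_measure_rV
  measure_rV0 measure_rV_ge0 measure_rV_sigma_additive.

End LebesgueMeasure.

Arguments lebesgue_outer : clear implicits.
Arguments lebesgue_measure_rV : clear implicits.

(* Main.v *)
(* [F_ij] is half the quadratic form of [F] at [e_i + e_j] minus half of
   [F_ii + F_jj], and quadratic forms of [F] are convex; so everything follows
   from facts about a convex [f : R^d -> R], the last one being Aleksandrov's
   theorem.

   On a line, a subgradient of [f] is monotone, hence differentiable almost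
   everywhere (Vitali), and [f] has an expansion of order two almost everywhere.
   The points of R^d where this expansion along the direction [w] holds with
   second derivative [c] up to [e], for increments up to [d], form a closed set
   [K].  By Fubini, almost every point lies in such sets for all directions of a
   countable set that is dense up to scaling, and is, along every direction [v]
   of this set, a limit of points of each of the [K]'s that contain it: a point
   of a subset of a line that is isolated on one side lies in a null set.

   At such an [x], the functions [u |-> (f (x + s u) - f x - s p.u) / s^2] are
   convex and converge as [s] tends to 0 for a dense set of [u], hence locally
   uniformly; call the limit [phi].  The second difference of [f] in the
   direction [w] at points [x + s v] of [K] yields
   [phi (v + w) + phi (v - w) - 2 phi v = 2 phi w] in the limit.  So [phi] obeys
   the parallelogram law and is a quadratic form. *)
Require Import Defs.
From HB Require Import structures.
From mathcomp Require Import all_boot all_order all_algebra.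
From mathcomp Require Import finmap.
From mathcomp Require Import sesquilinear.
From mathcomp Require Import all_classical all_reals all_analysis.
From mathcomp Require Import measurable_realfun.
From mathcomp Require Import ring lra.

Set Implicit Arguments.
Unset Strict Implicit.
Unset Printing Implicit Defensive.

Import Order.TTheory GRing.Theory Num.Theory.
Import numFieldNormedType.Exports.

Local Open Scope classical_set_scope.
Local Open Scope ring_scope.

(** * Monotone functions of one variable *)

(** A convex function homogeneous of degree two, such as the square of a norm, has an exact
    expansion along every line through the origin without being quadratic. So expansions along the
    lines through [x] cannot suffice: the directions must be coupled by information at points other
    than [x]. This shapes the sets [K]: the range of increments is the same for the whole set, so
    that at a point [x + s v] of [K] with [s] small, increments comparable to [s] are still allowed.
    Precision, approximate second derivative and range are discretized as [1/(m+1)], [k/(m+1)] and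
    [1/(j+1)], so that there are countably many sets [K] and the null sets discarded for them have a
    null union. Closedness of [K] makes these sets Borel, as Fubini requires. Only functions of one
    variable are differentiated almost everywhere; no gradient map on R^d enters. *)

Section FineCover.
Context {R : realType}.
Implicit Types (A U : set R) (P : R -> R -> Prop) (D : seq nat)
  (I : nat -> R * R).
Notation mu := (@lebesgue_measure R).

Lemma mu_le A B : A `<=` B -> (mu A <= mu B)%E.
Proof. exact: (le_outer_measure (wlength idfun)^*%mu). Qed.

Lemma mu_leU A B : (mu (A `|` B) <= mu A + mu B)%E.
Proof. exact: (outer_measureU2 (wlength idfun)^*%mu). Qed.

Lemma mu_packing D (X : nat -> set R) U : uniq D -> measurable U ->
  {in D, forall i, measurable (X i) /\ X i `<=` U} ->
  {in D &, forall i j, i != j -> X i `&` X j = set0} ->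
  (\sum_(i <- D) mu (X i) <= mu U)%E.
Proof.
elim: D U => [|i D IH] U; first by rewrite big_nil.
move=> /= /andP[iD uD] mU XU Xdisj; rewrite big_cons.
have [mXi XiU] := XU _ (mem_head _ _).
rewrite -(setDKU XiU) setUC measureU//; last 2 first.
  exact: measurableD.
  by rewrite setDIK.
rewrite leeD2l//; apply: IH => //; first exact: measurableD.
  move=> j jD; have [mXj XjU] := XU j (@mem_behead _ (i :: D) j jD).
  split=> // x Xjx; split; [exact: XjU|move=> Xix].
  have ij : i != j by apply: contraNneq iD => ->.
  have := Xdisj i j (mem_head _ _) (@mem_behead _ (i :: D) j jD) ij.
  by rewrite -subset0 => /(_ x); apply.
by move=> j k jD kD; apply: Xdisj; rewrite inE ?jD ?kD orbT.
Qed.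

Lemma mu_covering D (X : nat -> set R) A :
  A `<=` [set x | exists2 i, i \in D & X i x] ->
  (mu A <= \sum_(i <- D) mu (X i))%E.
Proof.
elim: D A => [|i D IH] A AX.
  rewrite big_nil (_ : A = set0) ?measure0//.
  by rewrite -subset0 => x /AX[].
rewrite big_cons; have -> : A = (A `&` X i) `|` (A `\` X i).
  by rewrite setUIDK.
apply: (le_trans (mu_leU _ _)); apply: leeD; first by apply: mu_le; exact: subIsetr.
apply: IH => x [/AX[j]]; rewrite inE => /orP[/eqP->//|jD Xjx _].
by exists j.
Qed.

Lemma mu_itvcc (a b : R) : a <= b -> mu `[a, b]%classic = (b - a)%:E.
Proof.
rewrite lebesgue_measure_itv/= lte_fin le_eqVlt => /predU1P[->|->//].
by rewrite ltxx subrr.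
Qed.

Lemma mu_itvoo (a b : R) : a <= b -> mu `]a, b[%classic = (b - a)%:E.
Proof.
rewrite lebesgue_measure_itv/= lte_fin le_eqVlt => /predU1P[->|->//].
by rewrite ltxx subrr.
Qed.

Definition disjoint_itvs D I :=
  [/\ uniq D, {in D, forall i, (I i).1 < (I i).2} &
    {in D &, forall i j, i != j -> (I i).2 < (I j).1 \/ (I j).2 < (I i).1}].

(** This is Vitali's covering theorem. Rational end points make the candidate intervals countable;
    its applications first move given end points to rational ones. *)
Lemma fine_cover A P (e : R) : (mu A < +oo)%E ->
  (forall x, A x -> forall d, 0 < d -> exists l r : rat,
     [/\ ratr l < x < ratr r, ratr r - ratr l < d :> R & P (ratr l) (ratr r)]) ->
  0 < e ->
  exists D I, [/\ disjoint_itvs D I, {in D, forall i, P (I i).1 (I i).2} &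
    (mu (A `\` [set x | exists2 i, i \in D & ((I i).1 <= x <= (I i).2)%R])
      < e%:E)%E].
Proof.
move=> Afin AP e0.
(* [vitali_theorem_corollary] is about sequences of balls: enumerate the
   intervals with rational endpoints. *)
pose dec (n : nat) : rat * rat := odflt (0, 1) (choice.unpickle n).
pose c n : R := ratr (dec n).1.
(* A pair whose second entry is not positive gets radius 1, so that every ball is nondegenerate; [F]
   tests [P] on the ball actually obtained. *)
pose rd n : R := if 0 < (dec n).2 then ratr (dec n).2 else 1.
have rd0 n : 0 < rd n by rewrite /rd; case: ifPn => [|_]; rewrite ?ltr0q// ltr01.
pose B n := ball (c n) (rd n).
have B0 n : 0 < (radius (B n))%:num by rewrite radius_ball_num// ltW.
pose F := [set n | P (c n - rd n) (c n + rd n)].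
have vB : vitali_cover A B F.
  split=> [i|x Ax d d0]; first exact: is_ball_ball.
  have [l [r [/andP[lx xr] rl Plr]]] := AP x Ax d d0.
  pose q : rat * rat := ((l + r) / 2, (r - l) / 2).
  have lr : l < r by rewrite -(@ltr_rat R); exact: lt_trans xr.
  exists (choice.pickle q).
  have dq : dec (choice.pickle q) = q by rewrite /dec choice.pickleK.
  have q2 : 0 < q.2 by rewrite /q/= divr_gt0// subr_gt0.
  have cE : c (choice.pickle q) = (ratr l + ratr r) / 2.
    by rewrite /c dq /q/= rmorphM rmorphD fmorphV/= ratr_nat.
  have rE : rd (choice.pickle q) = (ratr r - ratr l) / 2.
    by rewrite /rd dq q2 /q/= rmorphM rmorphB fmorphV/= ratr_nat.
  split.
  - rewrite /F/= cE rE.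
    have -> : (ratr l + ratr r) / 2 - (ratr r - ratr l) / 2 = ratr l :> R by lra.
    by have -> : (ratr l + ratr r) / 2 + (ratr r - ratr l) / 2 = ratr r :> R by lra.
  - by rewrite /B ball_itv /= in_itv/= cE rE; apply/andP; split; lra.
  - by rewrite radius_ball_num ?ltW// rE; lra.
have [G [GF tG mG]] := vitali_theorem_corollary B0 Afin vB e0.
exists (enum_fset G), (fun n => (c n - rd n, c n + rd n)).
have clB n : closure (B n) = `[c n - rd n, c n + rd n]%classic.
  by rewrite /B closure_ballE closed_ball_itv.
split.
- split; first exact: fset_uniq.
    by move=> i iG /=; have := rd0 i; lra.
  move=> i j iG jG ij /=.
  have [//|h1] := ltP (c i + rd i) (c j - rd j); first by left.
  have [//|h2] := ltP (c j + rd j) (c i - rd i); first by right.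
  exfalso; move/eqP: ij; apply.
  apply: tG => //; rewrite /= !clB.
  exists (Num.max (c i - rd i) (c j - rd j)); split; rewrite /= in_itv/=; apply/andP; split.
  + by rewrite le_max lexx.
  + by rewrite ge_max h1 andbT; have := rd0 i; lra.
  + by rewrite le_max lexx orbT.
  + by rewrite ge_max h2/=; have := rd0 j; lra.
- by move=> i /GF.
- apply: le_lt_trans mG; apply: mu_le => x [Ax nx]; split=> //.
  rewrite -bigcup_fset => -[i iG]; rewrite clB/= in_itv/= => xi.
  by apply: nx; exists i.
Qed.

End FineCover.

(** * Covering estimates for the slopes of a monotone function *)

Section MonotoneDerivative.
Context {R : realType}.
Variable g : R -> R.
Hypothesis g_mono : {homo g : x y / x <= y}.
Implicit Types (A : set R) (D : seq nat) (I : nat -> R * R) (a b : R).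
Notation mu := (@lebesgue_measure R).

Definition slope_gt b (l r : R) := b * (r - l) < g r - g l.
Definition slope_lt b (l r : R) := g r - g l < b * (r - l).

(* The open intervals with end points [g l], [g r] are disjoint when the intervals
   [[l, r]] are: this reduces the comparison to the additivity of Lebesgue measure. *)
Lemma increments_le D I D' I' : disjoint_itvs D I -> disjoint_itvs D' I' ->
  {in D', forall i', exists2 i, i \in D &
     (I i).1 <= (I' i').1 /\ (I' i').2 <= (I i).2} ->
  \sum_(i <- D') (g (I' i).2 - g (I' i).1) <=
  \sum_(i <- D) (g (I i).2 - g (I i).1).
Proof.
move=> [uD lD dD] [uD' lD' dD'] DD'.
rewrite -lee_fin -!sumEFin.
pose X i : set R := `]g (I' i).1, g (I' i).2[%classic.
pose Y i : set R := `[g (I i).1, g (I i).2]%classic.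
have -> : (\sum_(i <- D') (g (I' i).2 - g (I' i).1)%:E =
           \sum_(i <- D') mu (X i))%E.
  by apply: eq_big_seq => i iD'; rewrite mu_itvoo// g_mono// ltW// lD'.
have -> : (\sum_(i <- D) (g (I i).2 - g (I i).1)%:E = \sum_(i <- D) mu (Y i))%E.
  by apply: eq_big_seq => i iD; rewrite mu_itvcc// g_mono// ltW// lD.
apply: le_trans (_ : mu (\big[setU/set0]_(i <- D) Y i) <= _)%E.
  apply: mu_packing => //.
  - by apply: bigsetU_measurable => i _; exact: measurable_itv.
  - move=> i iD'; split; first exact: measurable_itv.
    have [j jD [h1 h2]] := DD' _ iD'.
    move=> x; rewrite /X/= in_itv/= => /andP[x1 x2].
    rewrite -bigcup_seq; exists j => //; rewrite /Y/= in_itv/=.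
    rewrite (le_trans (g_mono h1) (ltW x1))/=.
    exact: le_trans (ltW x2) (g_mono h2).
  - move=> i j iD jD ij; rewrite -subset0 => x [].
    rewrite /X/= !in_itv/= => /andP[x1 x2] /andP[x3 x4].
    have [/ltW /g_mono h|/ltW /g_mono h] := dD' i j iD jD ij.
      by have := lt_trans x3 (lt_le_trans x2 h); rewrite ltxx.
    by have := lt_trans x1 (lt_le_trans x4 h); rewrite ltxx.
apply: mu_covering => x; rewrite -bigcup_seq => -[i /= iD Yx].
by exists i.
Qed.

(** Cover [A], up to a small part, by disjoint steep intervals inside those of [D]: [b] times their
    total length is at most the sum of their increments, which [increments_le] bounds by that of
    [D]. *)
Lemma steep_measure_le A D I b : disjoint_itvs D I -> 0 < b ->
  A `<=` [set x | exists2 i, i \in D & (I i).1 < x < (I i).2] ->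
  (forall x, A x -> forall d, 0 < d -> exists l r,
     [/\ l < x < r, r - l < d & slope_gt b l r]) ->
  (b%:E * mu A <= (\sum_(i <- D) (g (I i).2 - g (I i).1))%:E)%E.
Proof.
move=> dI b0 AI Asteep.
set S := \sum_(i <- D) _.
have Afin : (mu A < +oo)%E.
  apply: (le_lt_trans (@mu_covering R D (fun i => `[(I i).1, (I i).2]%classic) A _)).
    move=> x /AI[i iD /andP[h1 h2]]; exists i => //.
    by rewrite /= in_itv/= !ltW.
  case: dI => _ lI _.
  rewrite (eq_big_seq (fun i => ((I i).2 - (I i).1)%:E)); last first.
    by move=> i iD; rewrite mu_itvcc// ltW// lI.
  by rewrite sumEFin ltry.
have Afn : mu A \is a fin_num by rewrite ge0_fin_numE.
rewrite -(fineK Afn) -EFinM lee_fin.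
apply/ler_addgt0Pr => e e0.
have eb0 : 0 < e / b by rewrite divr_gt0.
pose P l r := slope_gt b l r /\
  exists2 i, i \in D & (I i).1 <= l /\ r <= (I i).2.
have [|D' [I' [dI' PI' cI']]] := @fine_cover R A P _ Afin _ eb0.
- move=> x Ax d d0.
  have [i iD /andP[h1 h2]] := AI _ Ax.
  pose d' := Num.min d (Num.min (x - (I i).1) ((I i).2 - x)).
  have d'0 : 0 < d' by rewrite /d' !lt_min d0/= !subr_gt0 h1 h2.
  have [l [r [/andP[lx xr] lrd' sl]]] := Asteep x Ax _ d'0.
  move: lrd'; rewrite /d' !lt_min => /andP[lrd /andP[lr1 lr2]].
  (* Widening by less than [s] on each side reaches rational end points: by monotonicity the
     increment does not drop, and the last term of the minimum pays for the added length. *)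
  pose s := Num.min (d - (r - l)) (Num.min ((x - (I i).1) - (r - l))
    (Num.min (((I i).2 - x) - (r - l)) ((g r - g l - b * (r - l)) / b))) / 2.
  have : 0 < s.
    rewrite divr_gt0// !lt_min !subr_gt0 lrd lr1 lr2/= divr_gt0// subr_gt0.
    exact: sl.
  have [s1 s2 s3 s4] : [/\ s * 2 <= d - (r - l), s * 2 <= (x - (I i).1) - (r - l),
     s * 2 <= ((I i).2 - x) - (r - l) & s * 2 <= (g r - g l - b * (r - l)) / b].
    by rewrite divfK//; split; rewrite !ge_min lexx ?orbT.
  move=> s0.
  have [l' /[!in_itv]/= /andP[l1 l2]] : exists q, ratr q \in `]l - s, l[.
    by apply: rat_in_itvoo; lra.
  have [r' /[!in_itv]/= /andP[r1 r2]] : exists q, ratr q \in `]r, r + s[.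
    by apply: rat_in_itvoo; lra.
  exists l', r'; split.
  + by apply/andP; split; lra.
  + by lra.
  + split; last by exists i => //; split; lra.
    rewrite /slope_gt.
    have g1 : g (ratr l') <= g l by apply: g_mono; exact: ltW.
    have g2 : g r <= g (ratr r') by apply: g_mono; exact: ltW.
    have : b * (ratr r' - ratr l') < b * (r - l + s * 2).
      by rewrite ltr_pM2l//; lra.
    move: s4; rewrite ler_pdivlMr// => s4.
    have -> : b * (r - l + s * 2) = b * (r - l) + s * 2 * b by ring.
    by lra.
- have mA : (mu A <= (\sum_(i <- D') ((I' i).2 - (I' i).1))%:E + (e / b)%:E)%E.
    set C := [set x | exists2 i, i \in D' & (I' i).1 <= x <= (I' i).2] in cI'.
    have -> : A = (A `&` C) `|` (A `\` C) by rewrite setUIDK.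
    apply: (le_trans (mu_leU _ _)); apply: leeD; last exact: ltW.
    rewrite -sumEFin.
    have -> : (\sum_(i <- D') ((I' i).2 - (I' i).1)%:E =
        \sum_(i <- D') mu `[(I' i).1, (I' i).2]%classic)%E.
      apply: eq_big_seq => i iD; rewrite mu_itvcc// ltW//.
      by case: dI' => _ + _; apply.
    apply: (@mu_covering R D' (fun i => `[(I' i).1, (I' i).2]%classic)).
    by move=> x [_ [i iD xi]]; exists i => //; rewrite /= in_itv.
  move: mA; rewrite -(fineK Afn) -EFinD lee_fin => mA.
  have h1 : b * \sum_(i <- D') ((I' i).2 - (I' i).1) <=
      \sum_(i <- D') (g (I' i).2 - g (I' i).1).
    rewrite mulr_sumr big_seq [leRHS]big_seq; apply: ler_sum => i iD.
    by apply: ltW; case: (PI' _ iD).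
  have h2 := increments_le dI dI' (fun i iD => (PI' i iD).2).
  apply: (@le_trans _ _ (b * (\sum_(i <- D') ((I' i).2 - (I' i).1) + e / b))).
    by rewrite ler_pM2l.
  rewrite mulrDr mulrCA divff ?gt_eqF// mulr1 lerD2r.
  exact: le_trans h2.
Qed.

(** [steep_measure_le] with the single interval from [- N] to [N] bounds [b * mu A] independently of
    [b]. *)
Lemma steep_null A (N : R) : A `<=` `]-N, N[ ->
  (forall x, A x -> forall b d, 0 < d -> exists l r,
     [/\ l < x < r, r - l < d & slope_gt b l r]) -> mu A = 0%E.
Proof.
move=> AN Asteep.
have [N0|N0] := leP N 0.
  rewrite (_ : A = set0) ?measure0// -subset0 => x /AN/=.
  by rewrite ?in_itv/= => /andP[h1 h2]; lra.
pose I (n : nat) : R * R := (- N, N).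
have dI : disjoint_itvs [:: 0%N] I.
  split=> // [i _|i j]; first by rewrite /I/=; lra.
  by rewrite !inE => /eqP-> /eqP->; rewrite eqxx.
have bA b : 0 < b -> (b%:E * mu A <= (g N - g (- N))%:E)%E.
  move=> b0; have := @steep_measure_le A _ _ b dI b0 _ _.
  rewrite big_seq1; apply; last by move=> x Ax d d0; exact: Asteep.
  by move=> x /AN/=; rewrite ?in_itv/= => xN; exists 0%N => //; rewrite inE.
have Afn : mu A \is a fin_num.
  have := bA 1 ltr01; rewrite mul1e => h.
  by rewrite ge0_fin_numE//; apply: le_lt_trans h _; rewrite ltry.
have A0 : 0 <= fine (mu A) by exact: fine_ge0.
apply/eqP; rewrite -(fineK Afn) eqe eq_le A0 andbT leNgt; apply/negP => Ap.
set K := g N - g (- N) in bA.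
have K0 : 0 <= K by rewrite subr_ge0 g_mono//; lra.
have := bA ((K + 1) / fine (mu A)) _.
rewrite -{3}(fineK Afn) -EFinM lee_fin divfK ?gt_eqF// => h.
by have := h (divr_gt0 _ Ap); lra.
Qed.

(* Cover [A] by flat intervals in an open set of measure at most [mu A + e], then
   the part of [A] inside these intervals by steep ones: the total increments give
   [b * (mu A - e) <= a * (mu A + e)]. *)
Lemma crossing_null A (N a b : R) : 0 < a < b -> A `<=` `]-N, N[ ->
  (forall x, A x -> forall d, 0 < d -> exists l r,
     [/\ l < x < r, r - l < d & slope_lt a l r]) ->
  (forall x, A x -> forall d, 0 < d -> exists l r,
     [/\ l < x < r, r - l < d & slope_gt b l r]) -> mu A = 0%E.
Proof.
move=> /andP[a0 ab] AN Aflat Asteep.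
have b0 : 0 < b := lt_trans a0 ab.
have Afin : (mu A < +oo)%E.
  apply: (le_lt_trans (mu_le AN)).
  by rewrite lebesgue_measure_itv/=; case: ifP => _; rewrite ?ltry// -EFinB ltry.
have Afn : mu A \is a fin_num by rewrite ge0_fin_numE.
have A0 : 0 <= fine (mu A) by exact: fine_ge0.
suff H e : 0 < e -> b * (fine (mu A) - e) <= a * (fine (mu A) + e).
  apply/eqP; rewrite -(fineK Afn) eqe eq_le A0 andbT leNgt; apply/negP => Ap.
  (* With this [e], [e * (a + b)] is half of [(b - a) * mu A], whereas [H] makes it at least
     [(b - a) * mu A]. *)
  pose e := (b - a) * fine (mu A) / (2 * (a + b)).
  have ab0 : 0 < a + b by lra.
  have e0 : 0 < e by rewrite divr_gt0 ?mulr_gt0//; lra.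
  have := H e e0.
  have : e * (a + b) = (b - a) * fine (mu A) / 2.
    by rewrite /e; field; lra.
  have : 0 < (b - a) * fine (mu A) by rewrite mulr_gt0//; lra.
  by nra.
move=> e0.
have [U [oU AU Ue]] := @outer_measure_open_le R A e e0.
have mU : measurable U by exact: measurable_realfun.open_measurable.
pose P l r := slope_lt a l r /\ `[l, r] `<=` U.
have [|D [I [dI PI cI]]] := @fine_cover R A P _ Afin _ e0.
- move=> x Ax d d0.
  have [d1 /= d10 dU] := open_subball oU (AU _ Ax).
  pose d' := Num.min d (d1 / 2).
  have d'0 : 0 < d' by rewrite lt_min d0 divr_gt0.
  have [l [r [/andP[lx xr] lrd' sl]]] := Aflat x Ax _ d'0.
  move: lrd'; rewrite /d' !lt_min => /andP[lrd lr1].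
  (* Dually to the steep case, the end points move inwards: the increment does not grow, and the
     last term pays for the lost length. *)
  pose s := Num.min (x - l) (Num.min (r - x)
    ((a * (r - l) - (g r - g l)) / a)) / 2.
  have : 0 < s.
    rewrite divr_gt0// !lt_min !subr_gt0 lx xr/= divr_gt0// subr_gt0.
    exact: sl.
  have [s1 s2 s3] : [/\ s * 2 <= x - l, s * 2 <= r - x &
     s * 2 <= (a * (r - l) - (g r - g l)) / a].
    by rewrite divfK//; split; rewrite !ge_min lexx ?orbT.
  move=> s0.
  have [l' /[!in_itv]/= /andP[l1 l2]] : exists q, ratr q \in `]l, l + s[.
    by apply: rat_in_itvoo; lra.
  have [r' /[!in_itv]/= /andP[r1 r2]] : exists q, ratr q \in `]r - s, r[.
    by apply: rat_in_itvoo; lra.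
  exists l', r'; split.
  + by apply/andP; split; lra.
  + by lra.
  + split.
      rewrite /slope_lt.
      have g1 : g l <= g (ratr l') by apply: g_mono; exact: ltW.
      have g2 : g (ratr r') <= g r by apply: g_mono; exact: ltW.
      have : a * (r - l - s * 2) < a * (ratr r' - ratr l').
        by rewrite ltr_pM2l//; lra.
      move: s3; rewrite ler_pdivlMr// => s3.
      have -> : a * (r - l - s * 2) = a * (r - l) - s * 2 * a by ring.
      by lra.
    move=> y /=; rewrite in_itv/= => /andP[y1 y2].
    apply: (dU (d1 / 2)).
    + by rewrite /= sub0r normrN gtr0_norm ?divr_gt0//; lra.
    + by rewrite divr_gt0.
    + by rewrite ball_itv/= in_itv/=; apply/andP; split; lra.
- have [uD lD dD] := dI.
  pose C := [set x | exists2 i, i \in D & (I i).1 <= x <= (I i).2].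
  (* [steep_measure_le] asks for points of the open intervals; the end points form a finite, hence
     null, set [Z]. *)
  pose A' := A `&` [set x | exists2 i, i \in D & (I i).1 < x < (I i).2].
  have mA' : (mu A <= mu A' + e%:E)%E.
    have -> : A = (A `&` C) `|` (A `\` C) by rewrite setUIDK.
    apply: (le_trans (mu_leU _ _)); apply: leeD; last exact: ltW.
    pose Z := [set x | exists2 i, i \in D & x = (I i).1] `|`
              [set x | exists2 i, i \in D & x = (I i).2].
    have Z0 : (mu Z <= 0)%E.
      apply: (le_trans (mu_leU _ _)); rewrite -[leRHS]adde0.
      have pt (f : nat -> R) : (mu [set x | exists2 i, i \in D & x = f i] <= 0)%E.
        apply: (le_trans (@mu_covering R D (fun i => [set f i]) _ _)) => //.
        by rewrite big1// => i _; rewrite lebesgue_measure_set1.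
      by apply: leeD; exact: pt.
    apply: (@le_trans _ _ (mu (A' `|` Z))).
      apply: mu_le => x [Ax [i iD /andP[]]].
      rewrite le_eqVlt => /predU1P[x1 _|x1]; first by right; left; exists i.
      rewrite le_eqVlt => /predU1P[x2|x2]; first by right; right; exists i.
      by left; split=> //; exists i => //; rewrite x1.
    by apply: (le_trans (mu_leU _ _)); rewrite -[leRHS]adde0 leeD2l.
  have h1 : (b%:E * mu A' <= (\sum_(i <- D) (g (I i).2 - g (I i).1))%:E)%E.
    apply: steep_measure_le => // [x []//|x [Ax _]]; exact: Asteep.
  have h2 : \sum_(i <- D) (g (I i).2 - g (I i).1) <=
            a * \sum_(i <- D) ((I i).2 - (I i).1).
    rewrite mulr_sumr big_seq [leRHS]big_seq; apply: ler_sum => i iD.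
    by apply: ltW; case: (PI _ iD).
  have h3 : ((\sum_(i <- D) ((I i).2 - (I i).1))%:E <= mu U)%E.
    rewrite -sumEFin.
    have -> : (\sum_(i <- D) ((I i).2 - (I i).1)%:E =
        \sum_(i <- D) mu `[(I i).1, (I i).2]%classic)%E.
      by apply: eq_big_seq => i iD; rewrite mu_itvcc// ltW// lD.
    apply: mu_packing => // [i iD|i j iD jD ij].
      by split; [exact: measurable_itv|case: (PI _ iD)].
    rewrite -subset0 => x []; rewrite /= !in_itv/= => /andP[x1 x2] /andP[x3 x4].
    by have [h|h] := dD i j iD jD ij; lra.
  have {h3} h3 : \sum_(i <- D) ((I i).2 - (I i).1) <= fine (mu A) + e.
    by rewrite -lee_fin EFinD fineK//; exact: le_trans h3 Ue.
  have A'fin : mu A' \is a fin_num.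
    rewrite ge0_fin_numE//; apply: le_lt_trans Afin; apply: mu_le.
    exact: subIsetl.
  move: mA' h1; rewrite -(fineK A'fin) -(fineK Afn) -EFinD lee_fin -EFinM lee_fin.
  move=> mA' h1.
  have : b * (fine (mu A) - e) <= b * fine (mu A') by rewrite ler_pM2l//; lra.
  have : a * \sum_(i <- D) ((I i).2 - (I i).1) <= a * (fine (mu A) + e).
    by rewrite ler_pM2l.
  by lra.
Qed.

End MonotoneDerivative.

(** * Convex functions of one variable *)

Section SecondOrderLine.
Context {R : realType}.
Notation mu := (@lebesgue_measure R).

Lemma mu_null_bigcup (F : nat -> set R) : (forall n, mu (F n) = 0%E) ->
  mu (\bigcup_n F n) = 0%E.
Proof.
move=> F0; apply/eqP; rewrite eq_le measure_ge0 andbT.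
apply: (le_trans (outer_measure_sigma_subadditive (wlength idfun)^*%mu F)).
by rewrite eseries0// => n _ _; exact: F0.
Qed.

Lemma mu_null_sub (A B : set R) : A `<=` B -> mu B = 0%E -> mu A = 0%E.
Proof.
move=> AB B0; apply/eqP; rewrite eq_le measure_ge0 andbT -B0.
exact: mu_le.
Qed.

(** Let [k] be least such that the slopes around [x] are eventually at most [k e]. If [k >= 2],
    slopes above [(k-1) e] occur at all small scales, so slopes below [(k-2) e] do not, or [x] would
    be in a crossing set; hence the slopes are within [e] of [(k-1) e]. *)
Lemma monotone_slope_ae (g : R -> R) (m : nat) : {homo g : x y / x <= y} ->
  mu [set x | ~ exists k j : nat, forall l r, l < x < r -> r - l < j.+1%:R^-1 ->
    `|g r - g l - k%:R / m.+1%:R * (r - l)| <= m.+1%:R^-1 * (r - l)] = 0%E.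
Proof.
move=> g_mono.
set e : R := m.+1%:R^-1.
have e0 : 0 < e by rewrite invr_gt0.
pose S b x := forall d, 0 < d -> exists l r,
  [/\ l < x < r, r - l < d & slope_gt g b l r].
pose T a x := forall d, 0 < d -> exists l r,
  [/\ l < x < r, r - l < d & slope_lt g a l r].
pose F1 (N : nat) : set R := [set x | - N%:R < x < N%:R /\ forall b, S b x].
pose F2 (k N : nat) : set R := [set x | - N%:R < x < N%:R /\
  (T (k.+1%:R * e) x /\ S (k.+2%:R * e) x)].
apply: (@mu_null_sub _ ((\bigcup_N F1 N) `|` (\bigcup_k \bigcup_N F2 k N))).
  move=> x /= bad.
  have [N Nx] : exists N : nat, - N%:R < x < N%:R.
    exists (Num.truncn `|x|).+1; rewrite -ltr_norml.
    exact: truncnS_gt.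
  apply: contrapT => /not_orP[nF1 nF2]; apply: bad.
  have nS b x' : ~ S b x' -> exists j : nat, forall l r, l < x' < r ->
      r - l < j.+1%:R^-1 -> g r - g l <= b * (r - l).
    move=> nSb; apply: contrapT => nj; apply: nSb => d d0.
    have [j jd] : exists j : nat, j.+1%:R^-1 < d.
      exists (Num.truncn d^-1); rewrite invf_plt ?posrE//; exact: truncnS_gt.
    apply: contrapT => H; apply: nj; exists j => l r lr rlj.
    rewrite leNgt; apply/negP => sl; apply: H; exists l, r; split=> //.
    exact: lt_trans jd.
  have nT a x' : ~ T a x' -> exists j : nat, forall l r, l < x' < r ->
      r - l < j.+1%:R^-1 -> a * (r - l) <= g r - g l.
    move=> nTb; apply: contrapT => nj; apply: nTb => d d0.
    have [j jd] : exists j : nat, j.+1%:R^-1 < d.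
      exists (Num.truncn d^-1); rewrite invf_plt ?posrE//; exact: truncnS_gt.
    apply: contrapT => H; apply: nj; exists j => l r lr rlj.
    rewrite leNgt; apply/negP => sl; apply: H; exists l, r; split=> //.
    exact: lt_trans jd.
  have [b nSb] : exists b, ~ S b x.
    apply: contrapT => H; apply: nF1; exists N => //; split=> // b.
    by apply: contrapT => ?; apply: H; exists b.
  have exk : exists k : nat, `[< ~ S (k%:R * e) x >].
    exists (Num.truncn (b / e)).+1; apply/asboolP => Sk; apply: nSb => d d0.
    have [l [r [lxr rl sl]]] := Sk d d0; exists l, r; split=> //.
    apply: le_lt_trans sl; rewrite ler_pM2r; last first.
      by case/andP: lxr => h1 h2; lra.
    by rewrite -ler_pdivrMr// ltW// truncnS_gt.
  case: (ex_minnP exk) => k /asboolP nSk kmin.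
  have [j0 j0P] := nS _ _ nSk.
  have dlr l r : l < x < r -> 0 <= g r - g l /\ 0 < r - l.
    by case/andP => h1 h2; rewrite subr_ge0 g_mono; lra.
  case: k nSk kmin j0P => [|[|k]] nSk kmin j0P.
  - exists 0%N, j0 => l r lxr rlj; rewrite mul0r mul0r subr0.
    have [h1 h2] := dlr _ _ lxr.
    rewrite ger0_norm//; apply: (le_trans (j0P _ _ lxr rlj)).
    by rewrite mul0r mul0r mulr_ge0// ltW.
  - exists 0%N, j0 => l r lxr rlj; rewrite mul0r mul0r subr0.
    have [h1 h2] := dlr _ _ lxr.
    by rewrite ger0_norm//; apply: (le_trans (j0P _ _ lxr rlj)); rewrite mul1r.
  have Sk : S (k.+1%:R * e) x.
    by apply: contrapT => nSk1; have := kmin k.+1 (asboolT nSk1); rewrite ltnn.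
  have [j1 j1P] : exists j : nat, forall l r, l < x < r ->
      r - l < j.+1%:R^-1 -> k%:R * e * (r - l) <= g r - g l.
    (* [crossing_null] needs a positive lower level; at level 0 monotonicity gives the bound. *)
    case: k {nSk kmin j0P} Sk => [|k] Sk.
      by exists 0%N => l r lxr _; rewrite mul0r mul0r; have [] := dlr _ _ lxr.
    apply: nT => Tk; apply: nF2; exists k => //; exists N => //.
  exists k.+1, (maxn j0 j1) => l r lxr rlj.
  have [h1 h2] := dlr _ _ lxr.
  have H0 : r - l < j0.+1%:R^-1.
    by apply: lt_le_trans rlj _; rewrite lef_pV2 ?posrE// ler_nat ltnS leq_maxl.
  have H1 : r - l < j1.+1%:R^-1.
    by apply: lt_le_trans rlj _; rewrite lef_pV2 ?posrE// ler_nat ltnS leq_maxr.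
  have := j0P _ _ lxr H0; have := j1P _ _ lxr H1.
  rewrite -/e -[k.+2%:R]natr1 -[k.+1%:R]natr1 ler_norml => A1 A2.
  by apply/andP; split; nra.
apply/eqP; rewrite eq_le measure_ge0 andbT; apply: (le_trans (mu_leU _ _)).
rewrite [X in (X + _)%E](_ : _ = 0%E) ?add0e.
  rewrite [leLHS](_ : _ = 0%E)//.
  apply: mu_null_bigcup => k; apply: mu_null_bigcup => N.
  apply: (@crossing_null _ _ g_mono _ N%:R (k.+1%:R * e) (k.+2%:R * e)).
  - by rewrite mulr_gt0//= ltr_pM2r// ltr_nat.
  - by move=> x [xN _]; rewrite /= in_itv.
  - by move=> x [_ []].
  - by move=> x [_ []].
apply: mu_null_bigcup => N; apply: (@steep_null _ _ g_mono _ N%:R).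
  by move=> x [xN _]; rewrite /= in_itv.
by move=> x [_ +] b; apply.
Qed.

Definition convex1 (h : R -> R) := forall x y t, 0 <= t <= 1 ->
  h (t * x + (1 - t) * y) <= t * h x + (1 - t) * h y.

(** [g x] is the left derivative, the supremum of the slopes to the left of [x]; it is finite
    because every slope to the right bounds them ([Lub]). *)
Lemma convex1_subgradient (h : R -> R) : convex1 h ->
  exists g : R -> R, forall x y, h x + g x * (y - x) <= h y.
Proof.
move=> ch.
pose L x : set R := [set (h x - h y) / (x - y) | y in [set y | y < x]].
have Lub x y z : y < x -> x < z -> (h x - h y) / (x - y) <= (h z - h x) / (z - x).
  move=> yx xz; rewrite ler_pdivrMr ?subr_gt0// mulrAC ler_pdivlMr ?subr_gt0//.
  have zy : 0 < z - y by lra.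
  have t01 : 0 <= (z - x) / (z - y) <= 1.
    by rewrite divr_ge0/= ?ler_pdivrMr//; lra.
  have := ch y z _ t01.
  have -> : (z - x) / (z - y) * y + (1 - (z - x) / (z - y)) * z = x.
    by field; lra.
  rewrite -(ler_pM2l zy).
  have -> : (z - y) * ((z - x) / (z - y) * h y + (1 - (z - x) / (z - y)) * h z) =
     (z - x) * h y + (x - y) * h z by field; lra.
  by lra.
exists (fun x => sup (L x)) => x y.
have hub z : x < z -> ubound (L x) ((h z - h x) / (z - x)).
  by move=> xz _ [w wx <-]; exact: Lub.
have [yx|xy|->] := ltgtP y x; last by rewrite subrr mulr0 addr0.
- have : (h x - h y) / (x - y) <= sup (L x).
    apply: ub_le_sup; last by exists y.
    by exists ((h (x + 1) - h x) / (x + 1 - x)); apply: hub; lra.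
  by rewrite ler_pdivrMr ?subr_gt0//; lra.
- have : sup (L x) <= (h y - h x) / (y - x).
    apply: ge_sup; last exact: hub.
    by exists ((h x - h (x - 1)) / (x - (x - 1))), (x - 1) => //=; lra.
  by rewrite ler_pdivlMr ?subr_gt0//; lra.
Qed.

Lemma subgradient_mono (h g : R -> R) :
  (forall x y, h x + g x * (y - x) <= h y) -> {homo g : x y / x <= y}.
Proof.
move=> hg x y; rewrite le_eqVlt => /predU1P[->//|xy].
have := hg x y; have := hg y x => h1 h2.
have : (g x - g y) * (y - x) <= 0 by lra.
by rewrite pmulr_lle0 ?subr_gt0// subr_le0.
Qed.

Lemma le_of_le_div (x y C : R) : (forall n, x <= y + C / n.+1%:R) -> x <= y.
Proof.
move=> H; apply/ler_addgt0Pr => e e0.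
apply: (le_trans (H (Num.truncn (C / e)))).
rewrite lerD2l ler_pdivrMr// mulrC -ler_pdivrMr//.
by rewrite ltW// truncnS_gt.
Qed.

(** A Riemann sum for [h] as the integral of [g]: taking the subgradient at the right end of each of
    [n + 1] equal steps costs an error [C t^2 / (2 (n + 1))]. *)
Lemma subgradient_upper (h g : R -> R) (x t C : R) :
  (forall x y, h x + g x * (y - x) <= h y) -> 0 < t ->
  (forall s, 0 <= s <= t -> g (x + s) - g x <= C * s) ->
  h (x + t) - h x <= g x * t + C * t ^+ 2 / 2.
Proof.
move=> hg t0 gC.
apply: (@le_of_le_div _ _ (C * t ^+ 2 / 2)) => n.
pose u := t / n.+1%:R.
have u0 : 0 < u by rewrite divr_gt0.
have H (i : nat) : (i <= n.+1)%N ->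
    h (x + i%:R * u) - h x <= g x * (i%:R * u) + C * u ^+ 2 * (i%:R * (i%:R + 1)) / 2.
  elim: i => [_|i IH iN]; first by rewrite !mul0r addr0 subrr !mulr0 mul0r addr0.
  have := IH (ltnW iN).
  have := hg (x + i.+1%:R * u) (x + i%:R * u).
  have := gC (i.+1%:R * u) _.
  have -> : 0 <= i.+1%:R * u <= t.
    apply/andP; split; first by rewrite mulr_ge0// ltW.
    rewrite /u mulrA ler_pdivrMr// mulrC ler_pM2l//.
    by rewrite ler_nat.
  rewrite -natr1 => /(_ isT) A1 A2 A3.
  have : (g (x + (i%:R + 1) * u) - g x) * u <= C * ((i%:R + 1) * u) * u.
    by rewrite ler_pM2r.
  by nra.
have := H n.+1 (leqnn _).
have -> : n.+1%:R * u = t by rewrite /u mulrC divfK// pnatr_eq0.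
move=> H'; apply: (le_trans H').
rewrite -addrA lerD2l le_eqVlt; apply/orP; left; apply/eqP.
rewrite /u; field.
by rewrite nat1r pnatr_eq0.
Qed.

(** The same Riemann sum, with the subgradient at the left end of each step. *)
Lemma subgradient_lower (h g : R -> R) (x t C : R) :
  (forall x y, h x + g x * (y - x) <= h y) -> 0 < t ->
  (forall s, 0 <= s <= t -> C * s <= g (x + s) - g x) ->
  g x * t + C * t ^+ 2 / 2 <= h (x + t) - h x.
Proof.
move=> hg t0 gC.
apply: (@le_of_le_div _ _ (C * t ^+ 2 / 2)) => n.
pose u := t / n.+1%:R.
have u0 : 0 < u by rewrite divr_gt0.
have H (i : nat) : (i <= n.+1)%N ->
    g x * (i%:R * u) + C * u ^+ 2 * (i%:R * (i%:R - 1)) / 2 <= h (x + i%:R * u) - h x.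
  elim: i => [_|i IH iN]; first by rewrite !mul0r addr0 subrr !mulr0 mul0r addr0.
  have := IH (ltnW iN).
  have := hg (x + i%:R * u) (x + i.+1%:R * u).
  have := gC (i%:R * u) _.
  have -> : 0 <= i%:R * u <= t.
    apply/andP; split; first by rewrite mulr_ge0// ltW.
    rewrite /u mulrA ler_pdivrMr// mulrC ler_pM2l//.
    by rewrite ler_nat ltnW.
  rewrite -natr1 => /(_ isT) A1 A2 A3.
  have : C * (i%:R * u) * u <= (g (x + i%:R * u) - g x) * u.
    by rewrite ler_pM2r.
  by nra.
have := H n.+1 (leqnn _).
have -> : n.+1%:R * u = t by rewrite /u mulrC divfK// pnatr_eq0.
move=> H'; rewrite -lerBlDr; apply: le_trans H'.
rewrite -addrA lerD2l le_eqVlt; apply/orP; left; apply/eqP.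
rewrite /u; field.
by rewrite nat1r pnatr_eq0.
Qed.

(** The hypothesis concerns intervals with [x] in their interior. Letting the left end tend to [x]
    gives increments from [x], since monotonicity squeezes [g x] between [g (x - u)] and
    [g (x + u)]. *)
Lemma slope_one_sided (g : R -> R) (x c e d : R) : {homo g : x y / x <= y} ->
  0 <= c -> 0 < e -> 0 < d ->
  (forall l r, l < x < r -> r - l < d ->
    `|g r - g l - c * (r - l)| <= e * (r - l)) ->
  forall s, 0 <= s -> s < d -> (c - e) * s <= g (x + s) - g x <= (c + e) * s.
Proof.
move=> g_mono c0 e0 d0 H s.
rewrite le_eqVlt => /predU1P[<- _|s0 sd].
  by rewrite addr0 subrr !mulr0 lexx.
apply/andP; split.
  apply/ler_addgt0Pr => b b0.
  pose u := Num.min ((d - s) / 2) (Num.min (d / 4) (b / (4 * (c + e)))).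
  have ce0 : 0 < 4 * (c + e) by lra.
  have u0 : 0 < u by rewrite !lt_min !divr_gt0//; lra.
  have [u1 u2 u3] : [/\ u <= (d - s) / 2, u <= d / 4 & u <= b / (4 * (c + e))].
    by rewrite /u; split; rewrite !ge_min lexx ?orbT.
  have := H (x - u) (x + s) _ _.
  have -> : x - u < x < x + s by apply/andP; split; lra.
  have -> : x + s - (x - u) < d by lra.
  move=> /(_ isT isT); rewrite ler_norml => /andP[A1 _].
  have := H (x - u) (x + u) _ _.
  have -> : x - u < x < x + u by apply/andP; split; lra.
  have -> : x + u - (x - u) < d by lra.
  move=> /(_ isT isT); rewrite ler_norml => /andP[_ A2].
  have A3 : g x <= g (x + u) by apply: g_mono; lra.
  move: u3; rewrite ler_pdivlMr// => u3.
  by nra.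
apply/ler_addgt0Pr => b b0.
pose u := Num.min ((d - s) / 2) (b / (c + e)).
have ce0 : 0 < c + e by lra.
have u0 : 0 < u by rewrite !lt_min !divr_gt0//; lra.
have [u1 u2] : [/\ u <= (d - s) / 2 & u <= b / (c + e)].
  by rewrite /u; split; rewrite !ge_min lexx ?orbT.
have := H (x - u) (x + s) _ _.
have -> : x - u < x < x + s by apply/andP; split; lra.
have -> : x + s - (x - u) < d by lra.
move=> /(_ isT isT); rewrite ler_norml => /andP[_ A2].
have A3 : g (x - u) <= g x by apply: g_mono; lra.
move: u2; rewrite ler_pdivlMr// => u2.
by nra.
Qed.

Definition slope1 (h : R -> R) (x t : R) := (h (x + t) - h x) / t.

(* Comparing two difference quotients eliminates the first derivative, so that
   the condition is closed in [x]. *)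
Definition expansion1 (h : R -> R) (m k j : nat) (x : R) :=
  forall t r, t != 0 -> r != 0 -> `|t| <= j.+1%:R^-1 -> `|r| <= j.+1%:R^-1 ->
  `|slope1 h x t - slope1 h x r - k%:R / m.+1%:R * (t - r) / 2|
    <= m.+1%:R^-1 * (`|t| + `|r|).

(** Integrating the slope bounds of a subgradient [g] gives [slope1 h x t = g x + c t / 2] up to
    [e |t| / 2] ([key]); the difference of two such quotients no longer contains [g x]. *)
Lemma expansion1_ae (h : R -> R) (m : nat) : convex1 h ->
  mu [set x | ~ exists k j, expansion1 h m k j x] = 0%E.
Proof.
move=> ch; have [g hg] := convex1_subgradient ch.
have g_mono := subgradient_mono hg.
apply: mu_null_sub (monotone_slope_ae m g_mono).
move=> x /= nex [k [j H]]; apply: nex.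
set e : R := m.+1%:R^-1 in H *.
have e0 : 0 < e by rewrite invr_gt0.
set c := k%:R / m.+1%:R in H *.
have c0 : 0 <= c by rewrite divr_ge0.
set d : R := j.+1%:R^-1 in H.
have d0 : 0 < d by rewrite invr_gt0.
exists k, j.+1.
have Hr := slope_one_sided g_mono c0 e0 d0 H.
have Hl s : 0 <= s -> s < d -> (c - e) * s <= g x - g (x - s) <= (c + e) * s.
  have gN_mono : {homo (fun y => - g (- y)) : y z / y <= z}.
    by move=> y z yz; rewrite lerN2 g_mono// lerN2.
  have HN a b : a < - x < b -> b - a < d ->
      `|- g (- b) - - g (- a) - c * (b - a)| <= e * (b - a).
    move=> /andP[ax xb]; have -> : b - a = - a - - b by lra.
    have -> : - g (- b) - - g (- a) = g (- a) - g (- b) by lra.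
    by apply: H; apply/andP; split; lra.
  move=> s0 sd; have := slope_one_sided gN_mono c0 e0 d0 HN s0 sd.
  by rewrite opprD !opprK [_ + g x]addrC.
have dj (t : R) : `|t| <= j.+2%:R^-1 -> `|t| < d.
  by move=> /le_lt_trans; apply; rewrite ltf_pV2 ?posrE// ltr_nat.
have key t : t != 0 -> `|t| <= j.+2%:R^-1 ->
    `|slope1 h x t - g x - c * t / 2| <= e / 2 * `|t|.
  move=> t0 /dj td; rewrite -(ler_pM2r (_ : 0 < `|t|)) ?normr_gt0//.
  rewrite -normrM !mulrBl /slope1 divfK//.
  have -> : e / 2 * `|t| * `|t| = e * t ^+ 2 / 2.
    by rewrite -mulrA -expr2 real_normK ?num_real//; lra.
  rewrite ler_norml.
  have [tp|tn|tE] := ltgtP t 0; last by rewrite tE eqxx in t0.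
    (* Negative increments reduce to positive ones for the reflected function [h (- y)], with
       subgradient [- g (- y)]. *)
    have hg' y z : h (- y) + - g (- y) * (z - y) <= h (- z).
      by have := hg (- y) (- z); lra.
    have nt0 : 0 < - t by lra.
    rewrite ltr0_norm// in td.
    have U := @subgradient_upper (fun y => h (- y)) (fun y => - g (- y)) (- x) (- t)
      (c + e) hg' nt0 _.
    have L := @subgradient_lower (fun y => h (- y)) (fun y => - g (- y)) (- x) (- t)
      (c - e) hg' nt0 _.
    have {}U := U _; have {}L := L _.
    rewrite /= !opprD !opprK sqrrN in U L.
    have {}U : h (x + t) - h x <= - g x * - t + (c + e) * t ^+ 2 / 2.
      apply: U => s /andP[s1 s2]; have /andP[h1 h2] := Hl s s1 (le_lt_trans s2 td).
      have -> : - (- x + s) = x - s by lra.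
      by lra.
    have {}L : - g x * - t + (c - e) * t ^+ 2 / 2 <= h (x + t) - h x.
      apply: L => s /andP[s1 s2]; have /andP[h1 h2] := Hl s s1 (le_lt_trans s2 td).
      have -> : - (- x + s) = x - s by lra.
      by lra.
    by apply/andP; split; nra.
  rewrite gtr0_norm// in td.
  have U : h (x + t) - h x <= g x * t + (c + e) * t ^+ 2 / 2.
    apply: subgradient_upper => // s /andP[s1 s2].
    by have /andP[] := Hr s s1 (le_lt_trans s2 td).
  have L : g x * t + (c - e) * t ^+ 2 / 2 <= h (x + t) - h x.
    apply: subgradient_lower => // s /andP[s1 s2].
    by have /andP[] := Hr s s1 (le_lt_trans s2 td).
  by apply/andP; split; nra.
move=> t r t0 r0 tj rj.
have -> : slope1 h x t - slope1 h x r - c * (t - r) / 2 =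
  (slope1 h x t - g x - c * t / 2) - (slope1 h x r - g x - c * r / 2) by lra.
apply: (le_trans (ler_normB _ _)).
have := key t t0 tj; have := key r r0 rj.
have := mulr_ge0 (ltW e0) (normr_ge0 t); have := mulr_ge0 (ltW e0) (normr_ge0 r).
by rewrite -/e; lra.
Qed.

End SecondOrderLine.

(** * Lebesgue outer measure of boxes *)

Section CountableSubadditivity.
Context {R : realType} {T : Type} {I : pointedType}.
Implicit Types (S : set I) (F : I -> set T).
Local Open Scope ereal_scope.

(** Padding by the empty set treats finite and infinite [S] alike, so that results on sequences of
    sets apply to countable covers. *)
Lemma countable_nat_enum S F : countable S -> exists G : nat -> set T,
  [/\ forall n, G n = set0 \/ exists2 i, S i & G n = F i,
      \bigcup_(i in S) F i = \bigcup_n G n &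
      forall m : set T -> \bar R, m set0 = 0 -> (forall A, 0 <= m A) ->
        \esum_(i in S) m (F i) = \sum_(n <oo) m (G n)].
Proof.
move=> /countable_bijP[A]; rewrite card_eq_sym => /card_set_bijP[e [eA einj esurj]].
pose G n := if n \in A then F (e n) else set0.
have GA n : n \in A -> G n = F (e n) by rewrite /G => ->.
exists G; split.
- move=> n; rewrite /G; case: ifPn => [/set_mem An|_]; last by left.
  by right; exists (e n) => //; exact: eA.
- apply/seteqP; split=> x [].
    move=> i Si Fx; have [n An eni] := esurj _ Si; exists n => //.
    by rewrite GA ?mem_set// eni.
  move=> n _; rewrite /G; case: ifPn => // /set_mem An Fx.
  by exists (e n) => //; exact: eA.
- move=> m m0 mge0.
  rewrite (@reindex_esum _ _ _ A S e)//.
  rewrite nneseries_esumT// esum_mkcond; apply: eq_esum => n _.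
  by rewrite /G; case: ifPn.
Qed.

End CountableSubadditivity.

Section OuterMeasureEsum.
Context {R : realType} {T : Type} {I : pointedType}.
Implicit Types (S : set I) (F : I -> set T).
Local Open Scope ereal_scope.

Lemma outer_measure_bigcup_esum (m : {outer_measure set T -> \bar R}) S F :
  countable S -> m (\bigcup_(i in S) F i) <= \esum_(i in S) m (F i).
Proof.
move=> cS; have [G [_ -> GE]] := @countable_nat_enum R T I S F cS.
rewrite (GE m (outer_measure0 m) (outer_measure_ge0 m)).
exact: outer_measure_sigma_subadditive.
Qed.

End OuterMeasureEsum.

Section MeasureEsum.
Context d {R : realType} {T : measurableType d} {I : pointedType}.
Implicit Types (S : set I) (F : I -> set T).
Local Open Scope ereal_scope.

Lemma measure_bigcup_esum (m : {measure set T -> \bar R}) S F A :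
  countable S -> measurable A -> (forall i, S i -> measurable (F i)) ->
  A `<=` \bigcup_(i in S) F i -> m A <= \esum_(i in S) m (F i).
Proof.
move=> cS mA mF; have [G [GF -> GE]] := @countable_nat_enum R T I S F cS.
rewrite (GE m (measure0 m) (measure_ge0 m)) => AG; apply: measure_sigma_subadditive => // n.
by have [->//|[i Si ->]] := GF n; exact: mF.
Qed.

End MeasureEsum.

Lemma max0_split (R : realType) (a b c : R) :
  Num.max 0 (b - a) = Num.max 0 (Num.min b c - a) + Num.max 0 (b - Num.max a c).
Proof.
have [bc|cb] := leP b c; have [ac|ca] := leP a c.
- by rewrite [Num.max 0 (b - c)]max_l ?addr0// subr_le0.
- by rewrite [RHS]addrC !max_l ?addr0//; lra.
- rewrite !max_r; lra.
- by rewrite [Num.max 0 (c - a)]max_l ?add0r// subr_le0 ltW.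
Qed.

Section Boxes.
Context {R : realType} {d : nat}.
Implicit Types (x a b : 'rV[R]_d) (X H : set 'rV[R]_d) (i : 'I_d) (c : R).
Local Notation leb := (lebesgue_outer R d).
Local Open Scope ereal_scope.

Lemma box_volume_ge0 (ab : 'rV[R]_d * 'rV[R]_d) : (0 <= box_volume ab)%R.
Proof. by apply: prodr_ge0 => i _; rewrite le_max lexx. Qed.

Lemma lebesgue_outer_box_le (ab : 'rV[R]_d * 'rV[R]_d) :
  leb (box ab) <= (box_volume ab)%:E.
Proof.
apply: ereal_inf_lbound; exists [set ab].
  by split; [exact: countable1|move=> x xab; exists ab].
by rewrite esum_set1// lee_fin box_volume_ge0.
Qed.

Definition set_coord i c x : 'rV[R]_d := \row_j (if j == i then c else x ord0 j).

Lemma box_volume_split i c (ab : 'rV[R]_d * 'rV[R]_d) :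
  (box_volume ab =
   box_volume (ab.1, set_coord i (Num.min (ab.2 ord0 i) c) ab.2) +
   box_volume (set_coord i (Num.max (ab.1 ord0 i) c) ab.1, ab.2))%R.
Proof.
rewrite /box_volume (bigD1 i)//= [X in _ = (X + _)%R](bigD1 i)//=.
rewrite [X in _ = (_ + X)%R](bigD1 i)//= !mxE eqxx.
under [in X in _ = (X + _)%R]eq_bigr => j ji do rewrite mxE (negPf ji).
under [in X in _ = (_ + X)%R]eq_bigr => j ji do rewrite mxE (negPf ji).
by rewrite -mulrDl (max0_split _ _ c).
Qed.

(** Cutting every box of a cover of [X] at [c] yields covers of both parts of [X], and the volumes
    add up ([box_volume_split]). The pieces contain their common face, so open and closed
    half-spaces are handled together. *)
Lemma halfspace_caratheodory i c H :
  [set x : 'rV[R]_d | (x ord0 i < c)%R] `<=` H -> H `<=` [set x : 'rV[R]_d | (x ord0 i <= c)%R] ->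
  leb.-caratheodory H.
Proof.
move=> cH Hc; apply: le_caratheodory_measurable => X.
apply: le_ereal_inf_tmp => _ [S [cS XS] <-].
pose f1 (ab : 'rV[R]_d * 'rV[R]_d) :=
  (ab.1, set_coord i (Num.min (ab.2 ord0 i) c) ab.2).
pose f2 (ab : 'rV[R]_d * 'rV[R]_d) :=
  (set_coord i (Num.max (ab.1 ord0 i) c) ab.1, ab.2).
have -> : \esum_(ab in S) (box_volume ab)%:E =
    \esum_(ab in S) (box_volume (f1 ab))%:E +
    \esum_(ab in S) (box_volume (f2 ab))%:E.
  rewrite -esumD; last 2 first.
  - by move=> ab _; rewrite lee_fin box_volume_ge0.
  - by move=> ab _; rewrite lee_fin box_volume_ge0.
  by apply: eq_esum => ab _; rewrite -EFinD -box_volume_split.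
(* Cutting need not be injective on [S], so subadditivity is applied to the family indexed by [S],
   not to the set of cut boxes. *)
have cover (f : _ -> 'rV[R]_d * 'rV[R]_d) Y : Y `<=` \bigcup_(ab in S) box (f ab) ->
    leb Y <= \esum_(ab in S) (box_volume (f ab))%:E.
  move=> YS; apply: (le_trans (le_lebesgue_outer YS)).
  apply: (le_trans (outer_measure_bigcup_esum _ _ cS)).
  by apply: le_esum => ab _; exact: lebesgue_outer_box_le.
apply: leeD; apply: cover => x [Xx].
  move=> /Hc/= xc; have [ab Sab xab] := XS x Xx.
  exists ab => // j; rewrite /= mxE; have := xab j; case: eqP => [->|//].
  by rewrite !in_itv/= => /andP[-> ?]; rewrite le_min xc andbT.
move=> nHx; have cx : (c <= x ord0 i)%R.
  by rewrite leNgt; apply/negP => /cH.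
have [ab Sab xab] := XS x Xx.
exists ab => // j; rewrite /= mxE; have := xab j; case: eqP => [->|//].
by rewrite !in_itv/= => /andP[? ->]; rewrite ge_max cx !andbT.
Qed.

Lemma box_caratheodory (ab : 'rV[R]_d * 'rV[R]_d) :
  leb.-cara.-measurable (box ab).
Proof.
have -> : box ab = \bigcap_(i in [set: 'I_d])
    ([set x : 'rV[R]_d | (x ord0 i <= ab.2 ord0 i)%R] `&`
     ~` [set x : 'rV[R]_d | (x ord0 i < ab.1 ord0 i)%R]).
  apply/seteqP; split=> x /=.
    move=> xab i _; have := xab i; rewrite in_itv/= => /andP[h1 h2].
    by split=> //=; apply/negP; rewrite -leNgt.
  move=> xab i; have [/= h1 /negP h2] := xab i Logic.I.
  by rewrite in_itv/= h1 andbT leNgt.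
apply: (@fin_bigcap_measurable _ (caratheodory_type leb)) => // i _.
apply: measurableI; last apply: measurableC.
  by apply: (@halfspace_caratheodory i (ab.2 ord0 i)) => // x /= /ltW.
by apply: (@halfspace_caratheodory i (ab.1 ord0 i)) => // x /= /ltW.
Qed.

End Boxes.

Definition boxes (R : realType) (d : nat) : set (set 'rV[R]_d) :=
  range (@box R d).
(** Borel sets rather than Caratheodory-measurable ones: their sections are measurable, and measures
    on them can be compared on boxes. *)
Definition borel_rV (R : realType) (d : nat) := g_sigma_algebraType (@boxes R d).

Section BoxMeasure.
Context {R : realType} {d : nat}.
Local Notation leb := (lebesgue_outer R d).
Local Notation T := (borel_rV R d).

HB.instance Definition _ := Measurable.on (borel_rV R d).

Definition box_measure (A : set (borel_rV R d)) : \bar R := lebesgue_outer R d A.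

Lemma borel_caratheodory (A : set 'rV[R]_d) :
  @measurable _ T A -> leb.-cara.-measurable A.
Proof.
suff : <<s @boxes R d >> `<=` leb.-cara.-measurable by apply.
apply: smallest_sub; first exact: sigma_algebra_measurable.
by move=> _ [ab _ <-]; exact: box_caratheodory.
Qed.

Let box_measure0 : box_measure set0 = 0%E.
Proof. exact: lebesgue_outer0. Qed.

Let box_measure_ge0 A : (0 <= box_measure A)%E.
Proof. exact: lebesgue_outer_ge0. Qed.

Let box_measure_sigma_additive : semi_sigma_additive box_measure.
Proof.
move=> A mA tA mUA; apply: (@caratheodory_measure_sigma_additive R _ leb A) => //.
- by move=> n; exact: borel_caratheodory.
- exact: borel_caratheodory.
Qed.

HB.instance Definition _ := isMeasure.Build _ _ _ box_measure
  box_measure0 box_measure_ge0 box_measure_sigma_additive.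

Lemma measurable_box ab : @measurable _ T (box ab).
Proof. by apply: sub_sigma_algebra; exists ab. Qed.

Definition cube (n : nat) : set 'rV[R]_d := box (const_mx (- n%:R), const_mx n%:R).

Lemma bigcup_cube : \bigcup_n cube n = setT.
Proof.
rewrite -subTset => x _.
exists (Num.truncn `|x|).+1 => // i; rewrite in_itv/= !mxE -ler_norml.
rewrite ltW//; apply: le_lt_trans (truncnS_gt _).
rewrite [leRHS]/Num.norm/= mx_normrE.
exact: (le_trans _ (le_bigmax _ _ (ord0, i))).
Qed.

Lemma lebesgue_outer_box_fin (ab : 'rV[R]_d * 'rV[R]_d) :
  (lebesgue_outer R d (box ab) < +oo)%E.
Proof. by apply: le_lt_trans (lebesgue_outer_box_le _) _; rewrite ltry. Qed.

Let box_measure_sigma_finite : sigma_finite setT box_measure.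
Proof.
exists cube; first by rewrite bigcup_cube.
by move=> n; split; [exact: measurable_box|exact: lebesgue_outer_box_fin].
Qed.

HB.instance Definition _ := Measure_isSigmaFinite.Build _ _ _ box_measure
  box_measure_sigma_finite.

Lemma open_borel (U : set 'rV[R]_d) : open U -> @measurable _ T U.
Proof.
move=> oU.
pose qbox (q : 'rV[rat]_d * nat) : set 'rV[R]_d :=
  box (\row_i (ratr (q.1 ord0 i) - q.2.+1%:R^-1), \row_i (ratr (q.1 ord0 i) + q.2.+1%:R^-1)).
pose F q := if pselect (qbox q `<=` U) then qbox q else set0.
have -> : U = \bigcup_q F q.
  apply/seteqP; split=> x; last by move=> [q _]; rewrite /F; case: pselect => [qU /qU|_ []].
  move=> Ux; have /nbhs_ballP[e e0 eU] : nbhs x U by exact: open_nbhs_nbhs.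
  have [n ne] : exists n : nat, n.+1%:R^-1 < e / 2.
    exists (Num.truncn (e / 2)^-1); rewrite invf_plt ?posrE ?divr_gt0//.
    exact: truncnS_gt.
  have n0 : 0 < n.+1%:R^-1 :> R by rewrite invr_gt0.
  set v : R := n.+1%:R^-1 in ne n0 *.
  have /choice[q qP] : forall i : 'I_d, exists q : rat,
      x ord0 i - v < ratr q < x ord0 i + v.
    move=> i; have [|q] := @rat_in_itvoo R (x ord0 i - v) (x ord0 i + v).
      by rewrite ltrBlDr -addrA ltrDl addr_gt0.
    by rewrite in_itv/= => qi; exists q.
  pose y : 'rV[rat]_d * nat := (\row_i q i, n).
  exists y => //; rewrite /F; case: pselect => [yU|[]].
    move=> i; rewrite in_itv/= !mxE -/v; have /andP[h1 h2] := qP i.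
    by apply/andP; split; lra.
  move=> z yz; apply: eU; split; first exact: e0.
  move=> a b; rewrite (ord1 a).
  have := yz b; rewrite in_itv/= !mxE -/v => /andP[z1 z2]; have /andP[h1 h2] := qP b.
  by rewrite /ball/= ltr_norml; apply/andP; split; lra.
apply: countable_bigcupT_measurable; first exact: countableP.
by move=> q; rewrite /F; case: pselect => [qU|qU] /=; [exact: measurable_box|exact: measurable0].
Qed.

Lemma closed_borel (A : set 'rV[R]_d) : closed A -> @measurable _ T A.
Proof.
move=> cA; rewrite -(setCK A); apply: measurableC; apply: open_borel.
exact: closed_openC.
Qed.

Lemma boxI (ab ab' : 'rV[R]_d * 'rV[R]_d) : exists ab'', box ab `&` box ab' = box ab''.
Proof.
exists (\row_i Num.max (ab.1 ord0 i) (ab'.1 ord0 i),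
        \row_i Num.min (ab.2 ord0 i) (ab'.2 ord0 i)).
apply/seteqP; split=> x.
  move=> [h h'] i; have := h i; have := h' i.
  by rewrite !in_itv/= !mxE ge_max le_min => /andP[-> ->] /andP[-> ->].
move=> h; split=> i; have := h i;
  by rewrite !in_itv/= !mxE ge_max le_min => /andP[/andP[? ?] /andP[? ?]]; apply/andP.
Qed.

Lemma lebesgue_outer_translate_le (A : set 'rV[R]_d) (u : 'rV[R]_d) :
  (leb [set x : 'rV[R]_d | A (x + u)%R] <= leb A)%E.
Proof.
apply: le_ereal_inf_tmp => _ [S [cS AS] <-].
pose f (ab : 'rV[R]_d * 'rV[R]_d) := (ab.1 - u, ab.2 - u).
apply: (@le_trans _ _ (leb (\bigcup_(ab in S) box (f ab)))).
  apply: le_lebesgue_outer => x /AS[ab Sab xab]; exists ab => // i.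
  by have := xab i; rewrite !in_itv/= !mxE lerBlDr lerBrDr.
apply: (le_trans (outer_measure_bigcup_esum _ _ cS)).
apply: le_esum => ab _; apply: (le_trans (lebesgue_outer_box_le _)).
rewrite lee_fin le_eqVlt; apply/orP; left; apply/eqP.
by apply: eq_bigr => i _; rewrite /= !mxE; congr (Num.max _ _); ring.
Qed.

Lemma lebesgue_outer_translate (A : set 'rV[R]_d) (u : 'rV[R]_d) :
  leb [set x : 'rV[R]_d | A (x + u)%R] = leb A.
Proof.
apply/eqP; rewrite eq_le lebesgue_outer_translate_le/=.
have AE : A = [set x : 'rV[R]_d | A (x - u + u)%R].
  by apply/seteqP; split=> x /=; rewrite subrK.
rewrite {1}AE.
exact: (lebesgue_outer_translate_le [set x : 'rV[R]_d | A (x + u)%R] (- u)%R).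
Qed.

End BoxMeasure.

(** * Null sets and lines *)

Lemma lebesgue_measure_itvcc (R : realType) (a b : R) :
  lebesgue_measure `[a, b]%classic = (Num.max 0 (b - a))%:E.
Proof.
have [h|h] := leP b a; rewrite lebesgue_measure_itv/= lte_fin.
  by rewrite ltNge h max_l// subr_le0.
by rewrite h max_r// subr_ge0 ltW.
Qed.

Section Fubini.
Context {R : realType} {n : nat}.
Local Notation mu := (@lebesgue_measure R).
Local Notation T := (borel_rV R).
Implicit Types (t : R) (y : 'rV[R]_n) (v x : 'rV[R]_n.+1).

Definition cons_rV t y : 'rV[R]_n.+1 :=
  \row_j (if unlift ord0 j is Some k then y ord0 k else t).
Definition tail_rV v : 'rV[R]_n := \row_k v ord0 (lift ord0 k).

Lemma cons_rV0 t y : cons_rV t y ord0 ord0 = t.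
Proof. by rewrite mxE unlift_none. Qed.

Lemma cons_rV_lift t y k : cons_rV t y ord0 (lift ord0 k) = y ord0 k.
Proof. by rewrite mxE liftK. Qed.

Lemma forall_ordS (P : 'I_n.+1 -> Prop) :
  P ord0 -> (forall k, P (lift ord0 k)) -> forall i, P i.
Proof. by move=> P0 PS i; case: (unliftP ord0 i) => [k|] ->. Qed.

Lemma cons_rV_shear t y v : v ord0 ord0 = 1 ->
  cons_rV 0 y + t *: v = cons_rV t (y + t *: tail_rV v).
Proof.
move=> v0; apply/rowP; apply: forall_ordS => [|k].
  by rewrite cons_rV0 mxE cons_rV0 add0r mxE v0 mulr1.
by rewrite cons_rV_lift mxE cons_rV_lift !mxE.
Qed.

Lemma measurable_coord k : measurable_fun setT (fun y : T n => y ord0 k : measurableTypeR R).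
Proof.
apply: (measurability _ (RGenOpens.measurableE R)).
move=> _ [_ [a [b ->]] <-]; rewrite setTI.
apply: (open_borel (U := (fun y : 'rV[R]_n => y ord0 k) @^-1` `]a, b[%classic)).
by apply: open_comp => [x _|]; [exact: coord_continuous|exact: interval_open].
Qed.

Lemma measurable_shear v :
  measurable_fun setT (fun p : measurableTypeR R * T n =>
    cons_rV 0 p.2 + p.1 *: v : T n.+1).
Proof.
apply: (@measurability _ _ _ (T n.+1) _ _ (@boxes R n.+1) erefl) => //.
move=> _ [_ [ab _ <-] <-]; rewrite setTI.
pose f (i : 'I_n.+1) (p : measurableTypeR R * T n) : measurableTypeR R :=
  cons_rV 0 p.2 ord0 i + p.1 * v ord0 i.
have mf i : measurable_fun setT (f i).
  apply: measurable_funD; last first.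
    by apply: measurable_funM => //; exact: measurable_cst.
  move: i; apply: forall_ordS => [|k].
    under eq_fun do rewrite cons_rV0; exact: measurable_cst.
  under eq_fun do rewrite cons_rV_lift.
  exact: (measurableT_comp (measurable_coord k) measurable_snd).
have -> : (fun p : measurableTypeR R * T n => cons_rV 0 p.2 + p.1 *: v : T n.+1)
      @^-1` box ab =
    \bigcap_(i in [set: 'I_n.+1]) (f i @^-1` `[ab.1 ord0 i, ab.2 ord0 i]%classic).
  apply/seteqP; split=> p /=.
    by move=> h i _; have := h i; rewrite /f /= !mxE.
  by move=> h i; have := h i Logic.I; rewrite /f /= !mxE.
apply: fin_bigcap_measurable => // i _; rewrite -[X in measurable X]setTI.
by apply: mf => //; exact: measurable_itv.
Qed.

Local Open Scope ereal_scope.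

Local Notation prodm := (mu \x (@box_measure R n)).

Lemma measurable_cons : measurable_fun setT
  (fun p : measurableTypeR R * T n => cons_rV p.1 p.2 : T n.+1).
Proof.
apply: eq_measurable_fun (measurable_shear (cons_rV 1 0)) => p _.
rewrite cons_rV_shear ?cons_rV0//; congr cons_rV; apply/rowP => k.
by rewrite !mxE liftK mxE mulr0 addr0.
Qed.

(** The image under [cons_rV] of the product of one-dimensional and [n]-dimensional Lebesgue
    measure; [box_measureE] identifies it with Lebesgue measure. *)
Definition sections_measure (A : set (T n.+1)) : \bar R :=
  prodm ((fun p : measurableTypeR R * T n => cons_rV p.1 p.2 : T n.+1) @^-1` A).

Let mcons (A : set (T n.+1)) : measurable A -> measurable
  ((fun p : measurableTypeR R * T n => cons_rV p.1 p.2 : T n.+1) @^-1` A).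
Proof.
by move=> mA; rewrite -[X in measurable X]setTI; apply: measurable_cons.
Qed.

Let sections_measure0 : sections_measure set0 = 0.
Proof. by rewrite /sections_measure preimage_set0 measure0. Qed.

Let sections_measure_ge0 A : 0 <= sections_measure A.
Proof. exact: measure_ge0. Qed.

Let sections_measure_sigma_additive : semi_sigma_additive sections_measure.
Proof.
move=> F mF tF mUF; rewrite /sections_measure preimage_bigcup.
apply: measure_semi_sigma_additive.
- by move=> k; exact: mcons.
- apply/trivIsetP => /= i j _ _ ij; rewrite -preimage_setI.
  by move/trivIsetP : tF => /(_ _ _ _ _ ij) ->//; rewrite preimage_set0.
- by rewrite -preimage_bigcup; exact: mcons.
Qed.

HB.instance Definition _ := isMeasure.Build _ _ _ sections_measure
  sections_measure0 sections_measure_ge0 sections_measure_sigma_additive.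

Lemma sections_measure_box (ab : 'rV[R]_n.+1 * 'rV[R]_n.+1) :
  sections_measure (box ab) =
  (Num.max 0 (ab.2 ord0 ord0 - ab.1 ord0 ord0))%:E *
  lebesgue_outer R n (box (tail_rV ab.1, tail_rV ab.2)).
Proof.
rewrite /sections_measure.
have -> : (fun p : measurableTypeR R * T n => cons_rV p.1 p.2 : T n.+1) @^-1` box ab =
    `[ab.1 ord0 ord0, ab.2 ord0 ord0]%classic `*` box (tail_rV ab.1, tail_rV ab.2).
  apply/seteqP; split=> -[t y] /=.
    move=> h; split=> [|k]; first by have := h ord0; rewrite cons_rV0.
    by have := h (lift ord0 k); rewrite cons_rV_lift !mxE.
  move=> [h0 hk]; apply: forall_ordS => [|k]; first by rewrite cons_rV0.
  by have := hk k; rewrite cons_rV_lift !mxE.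
rewrite product_measure1E//; last exact: measurable_box.
by congr (_ * _); exact: lebesgue_measure_itvcc.
Qed.

End Fubini.

Section BoxMeasureBox.
Context {R : realType}.
Local Open Scope ereal_scope.
Local Notation mu := (@lebesgue_measure R).

Lemma box_volumeS n (ab : 'rV[R]_n.+1 * 'rV[R]_n.+1) :
  box_volume ab = (Num.max 0 (ab.2 ord0 ord0 - ab.1 ord0 ord0) *
    box_volume (tail_rV ab.1, tail_rV ab.2))%R.
Proof.
by rewrite /box_volume big_ord_recl; congr (_ * _)%R; apply: eq_bigr => k _; rewrite !mxE.
Qed.

(** The substance is that no countable cover has a smaller total volume. By induction
    [sections_measure] is a measure whose value on boxes is the volume; its countable subadditivity
    replaces a compactness argument. *)
Lemma lebesgue_outer_box d (ab : 'rV[R]_d * 'rV[R]_d) :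
  lebesgue_outer R d (box ab) = (box_volume ab)%:E.
Proof.
elim: d => [|n IH] in ab *; apply/eqP; rewrite eq_le lebesgue_outer_box_le/=;
  apply: le_ereal_inf_tmp => _ [S [cS AS] <-].
  (* In dimension 0 the box contains the point 0, so a cover has at least one box, and that box has
     volume 1. *)
  have [|ab' Sab' _] := AS 0%R; first by case.
  rewrite {1}/box_volume big_ord0; apply: esum_ge; exists [set ab'].
    by split=> // _ ->.
  by rewrite fsbig_set1 /box_volume big_ord0.
have volE (ab' : 'rV[R]_n.+1 * 'rV[R]_n.+1) : 
    (box_volume ab')%:E = sections_measure (box ab').
  by rewrite sections_measure_box IH box_volumeS EFinM.
rewrite volE; under eq_esum do rewrite volE.
apply: measure_bigcup_esum => //; first exact: measurable_box.
by move=> ab' _; exact: measurable_box.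
Qed.

Lemma box_measureE n (A : set (borel_rV R n.+1)) : measurable A ->
  lebesgue_outer R n.+1 A = sections_measure A.
Proof.
rewrite -[lebesgue_outer R n.+1 A]/(box_measure A).
apply: (@measure_unique _ R (borel_rV R n.+1) (@boxes R n.+1) (@cube R n.+1)) => //.
- by move=> _ _ [ab _ <-] [ab' _ <-]; have [ab'' ->] := boxI ab ab'; exists ab''.
- by move=> k; exists (const_mx (- (k%:R : R))%R, const_mx (k%:R : R)%R).
- exact: bigcup_cube.
- move=> _ [ab _ <-]; have := sections_measure_box ab.
  by rewrite lebesgue_outer_box -EFinM -box_volumeS -lebesgue_outer_box.
- by move=> k; exact: lebesgue_outer_box_fin.
Qed.

(* The shear [(t, y) |-> cons_rV 0 y + t *: v] sends lines parallel to the first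
   axis to lines of direction [v], and preserves the measure of the slices at
   fixed [t], which it translates. *)
Lemma null_of_null_lines n (B : set 'rV[R]_n.+1) (v : 'rV[R]_n.+1) :
  v ord0 ord0 = 1%R -> @measurable _ (borel_rV R n.+1) B ->
  (forall x, mu [set t : R | B (x + t *: v)%R] = 0) ->
  lebesgue_outer R n.+1 B = 0.
Proof.
move=> v0 mB Bnull; rewrite box_measureE//.
pose s (p : measurableTypeR R * borel_rV R n) : borel_rV R n.+1 :=
  (cons_rV 0 p.2 + p.1 *: v)%R.
pose c (p : measurableTypeR R * borel_rV R n) : borel_rV R n.+1 :=
  cons_rV p.1 p.2.
have ms : measurable (s @^-1` B).
  by rewrite -[X in measurable X]setTI; apply: measurable_shear.
have mc : measurable (c @^-1` B).
  by rewrite -[X in measurable X]setTI; apply: measurable_cons.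
transitivity ((mu \x @box_measure R n) (s @^-1` B)).
  rewrite /sections_measure; apply: eq_integral => t _.
  rewrite /= /box_measure -(lebesgue_outer_translate _ (t *: tail_rV v)).
  congr (lebesgue_outer R n _); apply/seteqP; split=> y /=.
    by rewrite /xsection/= !inE/= /s/= cons_rV_shear.
  by rewrite /xsection/= !inE/= /s/= cons_rV_shear.
(* Integrating in [t] first, at fixed [y], the sections are the traces of [B] on lines of direction
   [v], which are null. *)
rewrite (@product_measure_unique _ _ _ _ _ mu (@box_measure R n) (mu \x^ @box_measure R n))//.
  apply: integral0_eq => y _ /=.
  rewrite -[RHS](Bnull (cons_rV 0 y)); congr (mu _).
  by apply/seteqP; split=> t; rewrite /ysection/= inE.
by move=> A1 A2 mA1 mA2; exact: product_measure2E.
Qed.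

End BoxMeasureBox.

(** * Convex functions of several variables *)

Section ConvexFunctions.
Context {R : realType}.

Definition convexV (V : lmodType R) (f : V -> R) := forall x y (t : R), 0 <= t <= 1 ->
  f (t *: x + (1 - t) *: y) <= t * f x + (1 - t) * f y.

Lemma convexV_half (V : lmodType R) (f : V -> R) x y : convexV f ->
  f (x + y) <= (f (2 *: x) + f (2 *: y)) / 2.
Proof.
move=> cf; have := cf (2 *: x) (2 *: y) 2^-1 _.
have -> : 2^-1 *: (2 *: x) + (1 - 2^-1) *: (2 *: y) = x + y.
  by rewrite !scalerA mulVf// scale1r (_ : (1 - 2^-1) * 2 = 1) ?scale1r//; lra.
have h : 0 <= (2^-1 : R) <= 1 by lra.
by move=> /(_ h); lra.
Qed.

(* Splitting off one term of the sum doubles the other ones, whence the factor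
   [2 ^+ size s]; the bound [M] itself does not grow. *)
Lemma convexV_bound (V : lmodType R) (f : V -> R) (I : eqType) (s : seq I)
    (b : I -> V) (c : I -> R) (r M : R) : convexV f -> f 0 <= M ->
  (forall i a, i \in s -> `|a| <= r * 2 ^+ size s -> f (a *: b i) <= M) ->
  (forall i, i \in s -> `|c i| <= r) ->
  f (\sum_(i <- s) c i *: b i) <= M.
Proof.
move=> cf f0; elim: s c r => [|i s IH] c r bM cr; first by rewrite big_nil.
have r0 : 0 <= r by apply: le_trans (cr i (mem_head _ _)).
have p0 : 1 <= 2 ^+ size s :> R by rewrite exprn_ege1// ler1n.
rewrite big_cons; apply: (le_trans (convexV_half _ _ cf)).
have h1 : f (2 *: (c i *: b i)) <= M.
  rewrite scalerA; apply: bM; first exact: mem_head.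
  rewrite normrM ger0_norm// /= exprS mulrCA ler_pM2l//.
  apply: (le_trans (cr i (mem_head _ _))).
  by rewrite ler_peMr.
have h2 : f (2 *: \sum_(j <- s) c j *: b j) <= M.
  rewrite scaler_sumr; under eq_bigr do rewrite scalerA.
  apply: (IH _ (2 * r)).
    move=> j a js ar; apply: bM; first by rewrite inE js orbT.
    by rewrite /= exprS mulrCA mulrA.
  move=> j js; rewrite normrM ger0_norm// ler_pM2l//.
  by apply: cr; rewrite inE js orbT.
by lra.
Qed.

(** Midpoint convexity at 0 gives [0 <= (f x + f (- x)) / 2], so the upper bound at [- x] is a lower
    bound at [x]. *)
Lemma convexV_norm_bound (V : normedModType R) (f : V -> R) (r M : R) :
  convexV f -> f 0 = 0 -> (forall x, `|x| <= r -> f x <= M) ->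
  forall x, `|x| <= r -> `|f x| <= M.
Proof.
move=> cf f0 fM x xr; rewrite ler_norml fM// andbT.
have := @convexV_half _ f (2^-1 *: x) (- (2^-1 *: x)) cf.
rewrite subrr f0 scalerN !scalerA divff// scale1r => h.
have := fM (- x); rewrite normrN => /(_ xr).
by lra.
Qed.

(** Prolong the segment from [x] to [y] by length 1 beyond [y], to a point [z] of the larger ball;
    convexity between [x] and [z] bounds the slope between [x] and [y]. *)
Lemma convexV_lipschitz (V : normedModType R) (f : V -> R) (r M : R) :
  convexV f -> (forall x, `|x| <= r + 1 -> `|f x| <= M) ->
  forall x y, `|x| <= r -> `|y| <= r -> `|f x - f y| <= 2 * M * `|x - y|.
Proof.
move=> cf fM.
suff H x y : `|x| <= r -> `|y| <= r -> f y - f x <= 2 * M * `|y - x|.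
  move=> x y xr yr; rewrite ler_norml H// andbT lerNl opprB distrC.
  by rewrite [leRHS](_ : _ = 2 * M * `|y - x|) ?H.
move=> xr yr.
have [->|yx] := eqVneq y x; first by rewrite !subrr normr0 mulr0.
set a := `|y - x|; have a0 : 0 < a by rewrite normr_gt0 subr_eq0.
pose z := y + a^-1 *: (y - x).
have zr : `|z| <= r + 1.
  apply: (le_trans (ler_normD _ _)); apply: lerD => //.
  by rewrite normrZ normfV normr_id mulVf// gt_eqF.
have t01 : 0 <= a / (1 + a) <= 1.
  by rewrite divr_ge0 ?ler_pdivrMr ?mul1r; lra.
have := cf z x _ t01.
have -> : (a / (1 + a)) *: z + (1 - a / (1 + a)) *: x = y.
  have a1 : 1 + a != 0 by rewrite gt_eqF//; lra.
  have e1 : a / (1 + a) * a^-1 = (1 + a)^-1 by field; rewrite a1 gt_eqF.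
  have e2 : 1 - a / (1 + a) = (1 + a)^-1 by field.
  rewrite /z scalerDr scalerA e1 e2 -addrA -scalerDr subrK -scalerDl.
  by rewrite -{2}[(1 + a)^-1]mul1r -mulrDl addrC divff// scale1r.
move=> h.
have xr1 : `|x| <= r + 1 by lra.
have := fM z zr; have := fM x xr1.
rewrite !ler_norml => /andP[x1 x2] /andP[z1 z2].
have t1 : a / (1 + a) <= a by rewrite ler_pdivrMr ?ler_peMr//; lra.
have : f y - f x <= a / (1 + a) * (f z - f x) by lra.
have t0 : 0 <= a / (1 + a) by case/andP: t01.
have M0 : 0 <= M by lra.
have : a / (1 + a) * (f z - f x) <= a / (1 + a) * (2 * M) by rewrite ler_wpM2l//; lra.
have : a / (1 + a) * (2 * M) <= a * (2 * M) by rewrite ler_wpM2r//; lra.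
by lra.
Qed.

Context {d : nat}.
Implicit Types (f : 'rV[R]_d -> R) (x y : 'rV[R]_d).

Lemma coord_le_norm x i : `|x ord0 i| <= `|x|.
Proof.
rewrite [leRHS]/Num.norm/= mx_normrE.
exact: (le_trans _ (le_bigmax _ _ (ord0, i))).
Qed.

Lemma norm_le_coord x (r : R) : 0 <= r -> (forall i, `|x ord0 i| <= r) -> `|x| <= r.
Proof.
move=> r0 xr; rewrite [leLHS]/Num.norm/= mx_normrE.
by apply: bigmax_le => // -[a i] _ /=; rewrite (ord1 a).
Qed.

(** On a segment of a coordinate axis, [f] is at most the larger of its end values; [convexV_bound]
    passes to the ball, and [r'] is the radius that it asks for on the axes. *)
Lemma convexV_rV_bound f r : convexV f -> exists M, forall x, `|x| <= r -> f x <= M.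
Proof.
move=> cf.
have [r0|r0] := ltP r 0.
  by exists 0 => x xr; have := le_lt_trans xr r0; rewrite ltNge normr_ge0.
pose r' := r * 2 ^+ size (enum 'I_d).
have r'0 : 0 <= r' by rewrite mulr_ge0// exprn_ge0.
pose e i : 'rV[R]_d := delta_mx ord0 i.
pose M := `|f 0| + \sum_i (`|f (r' *: e i)| + `|f (- r' *: e i)|).
have Mi i : `|f (r' *: e i)| + `|f (- r' *: e i)| <= M.
  by rewrite /M (bigD1 i)//= [leRHS]addrCA lerDl addr_ge0// sumr_ge0.
exists M => x xr.
rewrite (row_sum_delta x) -big_enum/=.
apply: (@convexV_bound _ f _ (enum 'I_d) e (fun i => x ord0 i) r M cf).
- by rewrite /M (le_trans (ler_norm _))// lerDl sumr_ge0// => j _; rewrite addr_ge0.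
- move=> i a _ ar.
  have fi : `|f (r' *: e i)| <= M /\ `|f (- r' *: e i)| <= M.
    by split; apply: le_trans (Mi i); rewrite ?lerDl ?lerDr.
  have {fi}[f1 f2] : f (r' *: e i) <= M /\ f (- r' *: e i) <= M.
    by split; apply: le_trans (ler_norm _) _; case: fi.
  have [r'e|r'p] := eqVneq r' 0.
    have : `|a| <= 0 by rewrite -[leRHS]r'e.
    by rewrite normr_le0 => /eqP ->; rewrite r'e in f1.
  have {}r'p : 0 < r' by rewrite lt_neqAle eq_sym r'p.
  move: ar; rewrite -/r' ler_norml => /andP[a1 a2].
  have t01 : 0 <= (a + r') / (2 * r') <= 1.
    by rewrite divr_ge0 ?ler_pdivrMr; lra.
  have := cf (r' *: e i) (- r' *: e i) _ t01.
  rewrite !scalerA -scalerDl.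
  have -> : (a + r') / (2 * r') * r' + (1 - (a + r') / (2 * r')) * - r' = a.
    by field; lra.
  move=> h; apply: (le_trans h); case/andP: t01 => t0 t1.
  have : (a + r') / (2 * r') * f (r' *: e i) <= (a + r') / (2 * r') * M by rewrite ler_wpM2l.
  have : (1 - (a + r') / (2 * r')) * f (- r' *: e i) <= (1 - (a + r') / (2 * r')) * M.
    by rewrite ler_wpM2l//; lra.
  by lra.
- by move=> i _; apply: le_trans xr; exact: coord_le_norm.
Qed.

Lemma convexV_rV_lipschitz f r : convexV f -> exists L, 0 <= L /\
  forall x y, `|x| <= r -> `|y| <= r -> `|f x - f y| <= L * `|x - y|.
Proof.
move=> cf; pose g x := f x - f 0.
have cg : convexV g by move=> x y t t01; rewrite /g; have := cf x y t t01; lra.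
have [M gM] := convexV_rV_bound (r + 1) cg.
have g0 : g 0 = 0 by rewrite /g subrr.
have M0 : 0 <= Num.max 0 M by rewrite le_max lexx.
have gM' x : `|x| <= r + 1 -> `|g x| <= Num.max 0 M.
  by apply: (convexV_norm_bound cg g0) => y /gM h; rewrite le_max h orbT.
exists (2 * Num.max 0 M); split; first by rewrite mulr_ge0.
move=> x y xr yr; have := convexV_lipschitz cg gM' xr yr.
by rewrite /g; have -> : f x - f 0 - (f y - f 0) = f x - f y by lra.
Qed.

Lemma convexV_rV_continuous f : convexV f -> continuous f.
Proof.
move=> cf x; have [L [L0 fL]] := convexV_rV_lipschitz (`|x| + 1) cf.
apply/(@cvgrPdist_le R R^o 'rV[R]_d (nbhs x) (nbhs_filter x)) => e e0.
have L1 : 0 < L + 1 by lra.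
apply/(@nbhs_normP R 'rV[R]_d x); exists (Num.min 1 (e / (L + 1))).
  by rewrite /= lt_min ltr01 divr_gt0.
move=> y /=; rewrite lt_min => /andP[/ltW xy1 /ltW xy2].
have yr : `|y| <= `|x| + 1.
  rewrite -(subrK x y) addrC; apply: (le_trans (ler_normD _ _)).
  by rewrite lerD2l distrC.
have xr : `|x| <= `|x| + 1 by rewrite lerDl.
apply: (le_trans (fL x y xr yr)).
apply: (@le_trans _ _ ((L + 1) * `|x - y|)); first by rewrite ler_wpM2r// lerDl.
by rewrite mulrC -ler_pdivlMr.
Qed.

Lemma convexVP f : convex_function [set: 'rV[R]_d] f <-> convexV f.
Proof.
split=> [cf x y t /andP[t0 t1]|cf t x y _ _]; last first.
  by apply: cf; rewrite ge0 le1.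
pose t' : {i01 R} := Itv01 t0 t1.
by have := cf t' x y; rewrite !inE => /(_ Logic.I Logic.I).
Qed.

End ConvexFunctions.

(** * Exceptional sets of a convex function along lines *)

Section NullSets.
Context {R : realType} {n : nat}.
Local Notation mu := (@lebesgue_measure R).
Local Notation V := 'rV[R]_n.+1.
Local Notation leb := (lebesgue_outer R n.+1).
Implicit Types (f : V -> R) (v x : V) (A : set V).

Lemma lebesgue_outer_null_bigcup (d : nat) (F : nat -> set 'rV[R]_d) :
  (forall k, lebesgue_outer R d (F k) = 0%E) ->
  lebesgue_outer R d (\bigcup_k F k) = 0%E.
Proof.
move=> F0; apply/eqP; rewrite eq_le lebesgue_outer_ge0 andbT.
apply: (le_trans (lebesgue_outer_sigma_subadditive F)).
by rewrite eseries0// => k _ _; exact: F0.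
Qed.

Definition expansion f v (m k j : nat) x :=
  expansion1 (fun t => f (x + t *: v)) m k j 0.

Lemma expansion_line f v m k j x t :
  expansion f v m k j (x + t *: v) <-> expansion1 (fun s => f (x + s *: v)) m k j t.
Proof.
rewrite /expansion /expansion1.
have E s : slope1 (fun s => f (x + t *: v + s *: v)) 0 s =
           slope1 (fun s => f (x + s *: v)) t s.
  by rewrite /slope1 add0r scale0r addr0 scalerDl addrA.
by split=> H s r s0 r0 sj rj; have := H s r s0 r0 sj rj; rewrite !E.
Qed.

Lemma continuous_translate (u : V) : continuous (fun x : V => x + u).
Proof.
move=> x; apply: (@cvgD R V _ (nbhs x) (nbhs_filter x) (fun x => x) (fun=> u) x u).
  exact: cvg_id.
exact: cvg_cst.
Qed.

Lemma continuous_along v : continuous (fun p : R * V => p.2 + p.1 *: v).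
Proof.
move=> -[s x].
apply: (@cvgD R V _ (nbhs (s, x)) (nbhs_filter (s, x)) snd (fun p => p.1 *: v) x (s *: v)).
  exact: cvg_snd.
apply: (@cvgZr_tmp R V _ _ _ (fun p => p.1) s v); exact: cvg_fst.
Qed.

Lemma closed_expansion f v m k j : continuous f -> closed (expansion f v m k j).
Proof.
move=> cf.
have -> : expansion f v m k j =
  \bigcap_(p in [set p : R * R | [/\ p.1 != 0, p.2 != 0, `|p.1| <= j.+1%:R^-1 &
     `|p.2| <= j.+1%:R^-1]])
  [set x | `|slope1 (fun t => f (x + t *: v)) 0 p.1 -
     slope1 (fun t => f (x + t *: v)) 0 p.2 - k%:R / m.+1%:R * (p.1 - p.2) / 2|
    <= m.+1%:R^-1 * (`|p.1| + `|p.2|)].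
  apply/seteqP; split=> x H; first by move=> p [p1 p2 p3 p4]; exact: H.
  by move=> t r t0 r0 tj rj; exact: (H (t, r)).
apply: closed_bigI => -[t r] _ /=.
apply: (@closed_comp _ _ (fun x : V => `|slope1 (fun t => f (x + t *: v)) 0 t -
     slope1 (fun t => f (x + t *: v)) 0 r - k%:R / m.+1%:R * (t - r) / 2| : R^o)
     [set y | y <= m.+1%:R^-1 * (`|t| + `|r|)]); last exact: closed_le.
move=> x _.
have ct s : {for x, continuous (fun x : V => f (x + s *: v) : R^o)}.
  apply: (@continuous_comp _ _ _ (fun x : V => x + s *: v) f); last exact: cf.
  exact: continuous_translate.
have cs s : {for x, continuous (fun x : V => slope1 (fun t => f (x + t *: v)) 0 s : R^o)}.
  apply: continuousM; last exact: cst_continuous.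
  by apply: continuousB; exact: ct.
apply: (@continuous_comp _ _ _ (fun x : V => slope1 (fun t => f (x + t *: v)) 0 t -
     slope1 (fun t => f (x + t *: v)) 0 r - k%:R / m.+1%:R * (t - r) / 2 : R^o)
     (fun y : R^o => `|y| : R^o)); last exact: norm_continuous.
by apply: continuousB; [apply: continuousB|exact: cst_continuous].
Qed.

Lemma convex1_line f v x : convexV f -> convex1 (fun t => f (x + t *: v)).
Proof.
move=> cf t s a a01; have := cf (x + t *: v) (x + s *: v) a a01.
rewrite (_ : a *: _ + _ = x + (a * t + (1 - a) * s) *: v)//.
rewrite !scalerDr addrACA -scalerDl (_ : a + (1 - a) = 1); last by lra.
by rewrite scale1r !scalerA -scalerDl.
Qed.

(** The exceptional set is Borel because the expansion sets are closed, and it meets each line of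
    direction [v] in a null set by the one-variable result. *)
Lemma expansion_ae f v m : convexV f -> v ord0 ord0 = 1 ->
  leb [set x | ~ exists k j, expansion f v m k j x] = 0%E.
Proof.
move=> cf v0; apply: (@null_of_null_lines R n _ v v0).
  have -> : [set x | ~ exists k j, expansion f v m k j x] =
      ~` (\bigcup_k \bigcup_j expansion f v m k j).
    apply/seteqP; split=> x /= H.
      by move=> [k _ [j _ kj]]; apply: H; exists k, j.
    by move=> [k [j kj]]; apply: H; exists k => //; exists j.
  apply: measurableC; apply: bigcupT_measurable => k.
  apply: bigcupT_measurable => j; apply: closed_borel.
  by apply: closed_expansion; exact: convexV_rV_continuous.
move=> x; rewrite -[RHS](expansion1_ae m (convex1_line v x cf)).
congr (mu _); apply/seteqP; split=> t /= H [k [j kj]]; apply: H; exists k, j.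
  by apply/expansion_line.
by apply/expansion_line.
Qed.

(** An open window of length [d] contains at most one point of [A], and countably many such windows
    cover the line. *)
Lemma right_isolated_null (A : set R) (d : R) : 0 < d ->
  (forall t s, A t -> 0 < s <= d -> ~ A (t + s)) -> mu A = 0%E.
Proof.
move=> d0 Ad.
pose F (q : rat) := A `&` [set t | ratr q - d < t < ratr q].
pose G k := if choice.unpickle k is Some q then F q else set0.
apply: (@mu_null_sub _ _ (\bigcup_k G k)).
  move=> t At; have [q] : exists q, ratr q \in `]t, t + d[.
    by apply: rat_in_itvoo; lra.
  rewrite in_itv/= => /andP[q1 q2]; exists (choice.pickle q); first exact: Logic.I.
  rewrite /G choice.pickleK; split; first exact: At.
  by rewrite /mkset; apply/andP; split; lra.
apply: mu_null_bigcup => k; rewrite /G; case: choice.unpickle => [q|]; last first.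
  exact: measure0.
have [[t Ft]|F0] := pselect (exists t, F q t); last first.
  rewrite (_ : F q = set0) ?measure0// -subset0 => t Ft.
  by apply: F0; exists t.
rewrite (_ : F q = [set t]) ?lebesgue_measure_set1//.
apply/seteqP; split=> [s|_ -> //].
case: Ft => At /= /andP[t1 t2] [As /= /andP[s1 s2]].
have [ts|st|//] := ltgtP t s.
  exfalso; apply: (Ad t (s - t) At); first by apply/andP; split; lra.
  by rewrite addrC subrK.
exfalso; apply: (Ad s (t - s) As); first by apply/andP; split; lra.
by rewrite addrC subrK.
Qed.

(** The tube lemma for the compact segment of parameters. *)
Lemma open_forall_segment A v (a b : R) : closed A ->
  open [set x | forall s, a <= s <= b -> ~ A (x + s *: v)].
Proof.
move=> cA; rewrite openE => x Hx.
have := @segment_compact R a b; rewrite compact_near_coveringP.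
move=> /(_ V (nbhs x) (fun x s => ~ A (x + s *: v)) (nbhs_filter x)) H.
have : \forall x' \near x, `[a, b] `<=` (fun s => ~ A (x' + s *: v)).
  apply: H => s; rewrite /= in_itv/= => sab.
  have oA : open (~` A) by exact: closed_openC.
  have : nbhs (s, x) ((fun p : R * V => p.2 + p.1 *: v) @^-1` (~` A)).
    apply: (@continuous_along v (s, x)); apply: open_nbhs_nbhs; split=> //.
    exact: Hx.
  by [].
apply: filterS => y Hy s sab; apply: Hy.
by rewrite /= in_itv.
Qed.

Lemma right_isolated_ae A v : closed A -> v ord0 ord0 = 1 ->
  leb [set x | A x /\ exists2 d : R, 0 < d & forall s, 0 < s < d -> ~ A (x + s *: v)]
  = 0%E.
Proof.
move=> cA v0.
(* [F j] fixes the size of the gap, as the one-variable lemma requires; the half-open range of [s]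
   is a union of compact segments, which makes [F j] Borel. *)
pose F (j : nat) := [set x | A x /\ forall s, 0 < s <= j.+1%:R^-1 -> ~ A (x + s *: v)].
apply/eqP; rewrite eq_le lebesgue_outer_ge0 andbT.
apply: (@le_trans _ _ (leb (\bigcup_j F j))).
  apply: le_lebesgue_outer => x [Ax [d d0 H]].
  have [j jd] : exists j : nat, j.+1%:R^-1 < d.
    exists (Num.truncn d^-1); rewrite invf_plt ?posrE//; exact: truncnS_gt.
  exists j => //; split=> // s /andP[s0 sj]; apply: H.
  by rewrite s0 (le_lt_trans sj).
rewrite lebesgue_outer_null_bigcup// => j.
apply: (@null_of_null_lines R n _ v v0).
  have -> : F j = A `&` \bigcap_i
      [set x | forall s, i.+1%:R^-1 <= s <= j.+1%:R^-1 -> ~ A (x + s *: v)].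
    apply/seteqP; split=> x [Ax H]; split=> //.
      move=> i _ s /andP[s1 s2]; apply: H; rewrite s2 andbT.
      by apply: lt_le_trans s1; rewrite invr_gt0.
    move=> s /andP[s0 s1]; apply: (H (Num.truncn s^-1)) => //.
    rewrite s1 andbT ltW// invf_plt ?posrE//; exact: truncnS_gt.
  apply: measurableI; first exact: closed_borel.
  apply: bigcapT_measurable => i; apply: open_borel.
  exact: open_forall_segment.
move=> x; apply: (@right_isolated_null _ j.+1%:R^-1); first by rewrite invr_gt0.
move=> t s [At H] sj [At' _]; apply: (H s sj).
by rewrite -addrA -scalerDl.
Qed.

End NullSets.

(** * Quadratic forms, limits of families of functions *)

Section QuadraticForms.
Context {R : realType}.

(** Cauchy's equation: [N * a x] is the value at an integer, which is exact, plus the value at a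
    fractional part, which is bounded; dividing by [N] leaves an error of order [1/N]. *)
Lemma additive_bounded_linear (a : R -> R) (M : R) :
  {morph a : x y / x + y} -> (forall x, `|x| <= 1 -> `|a x| <= M) ->
  forall x, a x = x * a 1.
Proof.
move=> aD aM x.
have a0 : a 0 = 0 by have := aD 0 0; rewrite addr0; lra.
have aN y : a (- y) = - a y by have := aD y (- y); rewrite subrr a0; lra.
have aMn k y : a (k%:R * y) = k%:R * a y.
  elim: k => [|k IH]; first by rewrite !mul0r.
  by rewrite -natr1 mulrDl mul1r aD IH; lra.
have aMz (z : int) y : a (z%:~R * y) = z%:~R * a y.
  by case: z => k; rewrite ?NegzE ?mulrNz ?mulNr ?aN -?pmulrn aMn.
have M0 : 0 <= M by apply: le_trans (aM 0 _); rewrite ?normr0.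
suff H k : `|a x - x * a 1| <= 0 + 2 * M / k.+1%:R.
  by apply/eqP; rewrite -subr_eq0 -normr_le0; exact: le_of_le_div H.
set N : R := k.+1%:R; have N0 : 0 < N by rewrite /N.
pose z := Num.floor (N * x).
pose y := N * x - z%:~R.
have y01 : `|y| <= 1.
  have /andP[z1 z2] := mem_rg1_floor (N * x).
  by rewrite /y ger0_norm ?subr_ge0//; move: z1 z2; rewrite -/z; lra.
have E : N * a x = z%:~R * a 1 + a y.
  by rewrite -aMn -/N -(subrK (z%:~R) (N * x)) aD -/y addrC -{1}[z%:~R]mulr1 aMz.
rewrite add0r ler_pdivlMr// -[X in _ * X](gtr0_norm N0) -normrM.
have -> : (a x - x * a 1) * N = a y - y * a 1.
  by rewrite mulrBl [a x * N]mulrC E /y; ring.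
apply: (le_trans (ler_normB _ _)); rewrite normrM.
have := aM y y01; have := aM 1; rewrite normr1 lexx => /(_ isT) h1 h2.
have : `|y| * `|a 1| <= 1 * M by rewrite ler_pM.
by lra.
Qed.

Variable d : nat.
Local Notation V := 'rV[R]_d.
Variable phi : V -> R.
Hypothesis phi_bounded : forall r : R, exists M, forall u, `|u| <= r -> `|phi u| <= M.
Hypothesis phiZ : forall a u, phi (a *: u) = a ^+ 2 * phi u.
Hypothesis phi_par : forall u v, phi (u + v) + phi (u - v) = 2 * phi u + 2 * phi v.

(** The polar form, as in the Jordan-von Neumann theorem. *)
Let B u v := (phi (u + v) - phi (u - v)) / 4.

Let phiN u : phi (- u) = phi u.
Proof. by rewrite -scaleN1r phiZ sqrrN expr1n mul1r. Qed.

Let BC u v : B u v = B v u.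
Proof. by rewrite /B [u + v]addrC -[u - v]opprB phiN. Qed.

(** Subtract the parallelogram laws for [u + v, u' + v] and for [u - v, u' - v]. The right side
    depends only on [u + u'], so comparison with the pair [u + u', 0] yields additivity. *)
Let B2 u u' v : B u v + B u' v = B (u + u') (2 *: v) / 2.
Proof.
have h1 := phi_par (u + v) (u' + v); have h2 := phi_par (u - v) (u' - v).
have e1 : u + v + (u' + v) = u + u' + 2 *: v.
  by rewrite addrACA scaler_nat mulr2n.
have e2 : u + v - (u' + v) = u - u' by rewrite opprD addrACA subrr addr0.
have e3 : u - v + (u' - v) = u + u' - 2 *: v.
  by rewrite addrACA scaler_nat mulr2n opprD.
have e4 : u - v - (u' - v) = u - u' by rewrite opprB addrA subrK.
rewrite e1 e2 in h1; rewrite e3 e4 in h2.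
by rewrite /B; lra.
Qed.

Let BD u u' v : B (u + u') v = B u v + B u' v.
Proof.
rewrite B2; have := B2 (u + u') 0 v.
by rewrite addr0 /B sub0r add0r phiN; lra.
Qed.

Let BZ a u v : B (a *: u) v = a * B u v.
Proof.
have [M HM] := phi_bounded (`|u| + `|v|).
have -> : B u v = B (1 *: u) v by rewrite scale1r.
apply: (@additive_bounded_linear (fun a => B (a *: u) v) (M / 2)).
  by move=> x y; rewrite scalerDl BD.
move=> x x1; rewrite /B normrM [X in _ * X]ger0_norm//.
have xu : `|x *: u| <= `|u| by rewrite normrZ ler_piMl.
have h1 := HM (x *: u + v) (le_trans (ler_normD _ _) (lerD xu (lexx _))).
have h2 := HM (x *: u - v) (le_trans (ler_normB _ _) (lerD xu (lexx _))).
have := ler_normB (phi (x *: u + v)) (phi (x *: u - v)).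
by lra.
Qed.

Lemma quadratic_form : exists H : 'M[R]_d, H \is symmetricmx /\
  forall u, phi u = 2^-1 * (u *m H *m u^T) ord0 ord0.
Proof.
pose e i : V := delta_mx ord0 i.
exists (\matrix_(i, j) (2 * B (e i) (e j))); split.
  by rewrite qualifE/= expr0 scale1r; apply/eqP/matrixP => i j; rewrite !mxE BC.
move=> u.
have Bsum v (I : finType) (c : I -> R) (b : I -> V) :
    B (\sum_i c i *: b i) v = \sum_i c i * B (b i) v.
  apply: (big_ind2 (fun x y => B x v = y)) => [|x y z t <- <-|i _].
  - by rewrite -(scale0r 0) BZ mul0r.
  - exact: BD.
  - exact: BZ.
have -> : phi u = B u u.
  have -> : B u u = (phi (2 *: u) - phi (0 *: u)) / 4.
    by rewrite /B subrr scale0r scaler_nat mulr2n.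
  by rewrite !phiZ; lra.
have uE : u = \sum_j u ord0 j *: e j := row_sum_delta u.
rewrite {1}[in B u u]uE Bsum.
rewrite [(u *m _ *m _) _ _]mxE mulr_sumr.
under eq_bigr => i _.
  rewrite BC [in B u _]uE Bsum mulr_sumr.
  over.
rewrite exchange_big/=; apply: eq_bigr => j _.
rewrite !mxE big_distrl/= mulr_sumr; apply: eq_bigr => i _.
by rewrite !mxE [B (e j) _]BC; lra.
Qed.

End QuadraticForms.

Lemma half_itv (R : realType) (m s : R) : 0 < m -> m <= s -> 0 < m / 2 < s.
Proof. by move=> m0 ms; apply/andP; split; lra. Qed.

Section CauchyFamily.
Context {R : realType} {d : nat}.
Local Notation V := 'rV[R]_d.
Variables (g : R -> V -> R) (C : set V).
Hypothesis g_lip : forall r, 0 < r -> exists L s0, [/\ 0 <= L, 0 < s0 &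
  forall s, 0 < s < s0 -> forall u v, `|u| <= r -> `|v| <= r ->
    `|g s u - g s v| <= L * `|u - v|].
Hypothesis C_dense : forall u e, 0 < e -> exists2 c, C c & `|u - c| <= e.
Hypothesis g_cauchy : forall c e, C c -> 0 < e -> exists2 s0, 0 < s0 &
  forall s s', 0 < s < s0 -> 0 < s' < s0 -> `|g s c - g s' c| <= e.

Let g_cauchyT u e : 0 < e -> exists2 s0, 0 < s0 &
  forall s s', 0 < s < s0 -> 0 < s' < s0 -> `|g s u - g s' u| <= e.
Proof.
move=> e0; have r0 : 0 < `|u| + 1 by rewrite ltr_wpDl.
have [L [s0 [L0 s00 gL]]] := g_lip r0.
have L1 : 0 < 3 * (L + 1) by lra.
pose h := Num.min 1 (e / (3 * (L + 1))).
have h0 : 0 < h by rewrite lt_min ltr01 divr_gt0.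
have [h1 h2] : h <= 1 /\ h <= e / (3 * (L + 1)) by rewrite /h !ge_min !lexx orbT.
have [c Cc uc] := C_dense u h0.
have e3 : 0 < e / 3 by rewrite divr_gt0.
have [s1 s10 gc] := g_cauchy Cc e3.
have ur : `|u| <= `|u| + 1 by rewrite lerDl.
have cr : `|c| <= `|u| + 1.
  rewrite -(subrK u c) addrC; apply: (le_trans (ler_normD _ _)).
  by rewrite lerD2l distrC (le_trans uc).
have Luc : L * `|u - c| <= e / 3.
  have : L * `|u - c| <= (L + 1) * h.
    by rewrite ler_pM//; lra.
  move: h2; rewrite ler_pdivlMr// => h2; lra.
exists (Num.min s0 s1); first by rewrite lt_min s00.
move=> s s' /andP[sp]; rewrite lt_min => /andP[ss0 ss1].
move=> /andP[sp']; rewrite lt_min => /andP[ss0' ss1'].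
have I0 : 0 < s < s0 by rewrite sp.
have I0' : 0 < s' < s0 by rewrite sp'.
have I1 : 0 < s < s1 by rewrite sp.
have I1' : 0 < s' < s1 by rewrite sp'.
have A1 := gL _ I0 u c ur cr; have A2 := gL _ I0' u c ur cr.
have A3 := gc _ _ I1 I1'.
have -> : g s u - g s' u = (g s u - g s c) + (g s c - g s' c) + (g s' c - g s' u) by lra.
apply: (le_trans (ler_normD _ _)); rewrite (distrC (g s' c)).
apply: (le_trans (lerD (ler_normD _ _) (lexx _))); lra.
Qed.

(** The lower limit as [s] decreases to 0, as a supremum of eventual lower bounds; [phi_near] shows
    that it is the limit. *)
Let phi u := sup [set y | exists2 s0, 0 < s0 & forall s, 0 < s < s0 -> y <= g s u].

Let phi_near u e : 0 < e -> exists2 s0, 0 < s0 &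
  forall s, 0 < s < s0 -> `|g s u - phi u| <= e.
Proof.
move=> e0; have [s0 s00 gs] := g_cauchyT u e0.
exists s0 => // s ss.
have low : [set y | exists2 s0, 0 < s0 & forall s, 0 < s < s0 -> y <= g s u] (g s u - e).
  exists s0 => // s' ss'; have := gs _ _ ss ss'.
  by rewrite ler_norml; lra.
have up : ubound [set y | exists2 s0, 0 < s0 & forall s, 0 < s < s0 -> y <= g s u] (g s u + e).
  move=> y [s1 s10 H].
  pose s' := Num.min s0 s1 / 2.
  have m0 : 0 < Num.min s0 s1 by rewrite lt_min s00.
  have [m1 m2] : Num.min s0 s1 <= s0 /\ Num.min s0 s1 <= s1 by rewrite !ge_min !lexx orbT.
  have ss0 : 0 < s' < s0 by rewrite /s'; apply/andP; split; lra.
  have ss1 : 0 < s' < s1 by rewrite /s'; apply/andP; split; lra.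
  by have := H _ ss1; have := gs _ _ ss ss0; rewrite ler_norml; lra.
have p1 : g s u - e <= phi u by apply: ub_le_sup => //; exists (g s u + e).
have p2 : phi u <= g s u + e by apply: ge_sup => //; exists (g s u - e).
by rewrite ler_norml; apply/andP; split; lra.
Qed.

(** Equi-Lipschitz bounds spread convergence from a dense set to every point, then make it uniform
    on a compact cube, which is a ball of the sup norm. *)
Lemma cauchy_family : exists phi : V -> R,
  (forall r, 0 < r -> exists2 L, 0 <= L & forall u v, `|u| <= r -> `|v| <= r ->
    `|phi u - phi v| <= L * `|u - v|) /\
  (forall r e, 0 < r -> 0 < e -> exists2 s0, 0 < s0 &
    forall s u, 0 < s < s0 -> `|u| <= r -> `|g s u - phi u| <= e).
Proof.
exists phi.
have phi_lip r : 0 < r -> exists2 L, 0 <= L & forall u v, `|u| <= r -> `|v| <= r ->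
    `|phi u - phi v| <= L * `|u - v|.
  move=> r0; have [L [s0 [L0 s00 gL]]] := g_lip r0; exists L => // u v ur vr.
  apply/ler_addgt0Pr => e e0; have e2 : 0 < e / 2 by rewrite divr_gt0.
  have [s1 s10 H1] := phi_near u e2; have [s2 s20 H2] := phi_near v e2.
  pose m := Num.min s0 (Num.min s1 s2).
  have m0 : 0 < m by rewrite !lt_min s00 s10.
  have [m1 m2 m3] : [/\ m <= s0, m <= s1 & m <= s2].
    by rewrite /m; split; rewrite !ge_min lexx ?orbT.
  have A0 : 0 < m / 2 < s0 by exact: half_itv.
  have A1 : 0 < m / 2 < s1 by exact: half_itv.
  have A2 : 0 < m / 2 < s2 by exact: half_itv.
  have B0 := gL _ A0 u v ur vr; have B1 := H1 _ A1; have B2 := H2 _ A2.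
  have -> : phi u - phi v = (phi u - g (m / 2) u) + (g (m / 2) u - g (m / 2) v) +
      (g (m / 2) v - phi v) by lra.
  apply: (le_trans (ler_normD _ _)); apply: (le_trans (lerD (ler_normD _ _) (lexx _))).
  by rewrite (distrC (phi u)); lra.
split=> // r e r0 e0.
have cpt : compact [set u : V | forall i, `[- r, r]%classic (u ord0 i)].
  by apply: (@rV_compact _ _ (fun=> `[- r, r]%classic)) => i; exact: segment_compact.
move: cpt; rewrite compact_near_coveringP.
move=> /(_ R (0^'+) (fun s u => `|u| <= r -> `|g s u - phi u| <= e) _) H.
have : \forall s \near 0^'+, [set u : V | forall i, `[- r, r]%classic (u ord0 i)] `<=`
    (fun u => `|u| <= r -> `|g s u - phi u| <= e).
  apply: H => u uK.
  have ur : `|u| <= r.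
    by apply: norm_le_coord; [exact: ltW|move=> i; have := uK i; rewrite /= in_itv/= ler_norml].
  have [L [s0 [L0 s00 gL]]] := g_lip r0.
  have [L' L'0 phiL] := phi_lip r r0.
  have e3 : 0 < e / 3 by rewrite divr_gt0.
  have [s1 s10 H1] := phi_near u e3.
  have LL : 0 < 3 * (L + L' + 1) by lra.
  pose h := e / (3 * (L + L' + 1)).
  have h0 : 0 < h by rewrite divr_gt0.
  have hE : h * (3 * (L + L' + 1)) = e by rewrite /h divfK// gt_eqF.
  pose m := Num.min s0 s1.
  have m0 : 0 < m by rewrite !lt_min s00 s10.
  have [m1 m2] : m <= s0 /\ m <= s1 by rewrite !ge_min !lexx orbT.
  exists ([set v | `|u - v| < h], [set s | 0 < s < m]).
    split.
      by apply/(@nbhs_normP R V u); exists h.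
    near=> s; apply/andP; split; near: s; first exact: nbhs_right_gt.
    exact: nbhs_right_lt.
  move=> [v s] [/= uv /andP[sp sm]] vr.
  have A0 : 0 < s < s0 by rewrite sp (lt_le_trans sm).
  have A1 : 0 < s < s1 by rewrite sp (lt_le_trans sm).
  have B0 := gL _ A0 v u vr ur; have B1 := H1 _ A1; have B2 := phiL u v ur vr.
  have -> : g s v - phi v = (g s v - g s u) + (g s u - phi u) + (phi u - phi v) by lra.
  apply: (le_trans (ler_normD _ _)); apply: (le_trans (lerD (ler_normD _ _) (lexx _))).
  have : L * `|u - v| <= L * h by rewrite ler_wpM2l// ltW.
  have : L' * `|u - v| <= L' * h by rewrite ler_wpM2l// ltW.
  rewrite distrC in B0.
  by nra.
rewrite near_withinE => /nbhs_ballP[s0 /= s00 H0].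
exists s0 => // s u /andP[sp ss] ur.
apply: (H0 s) => //.
  by rewrite -ball_normE /= sub0r normrN gtr0_norm.
by move=> i; rewrite /= in_itv/= -ler_norml; apply: le_trans ur; exact: coord_le_norm.
Unshelve. all: by end_near. Qed.

End CauchyFamily.

Section LocallyLipschitz.
Context {R : realType} {d : nat}.
Local Notation V := 'rV[R]_d.
Implicit Types (h g : V -> R) (u v : V).

Definition loclip h := forall r, 0 < r -> exists2 L, 0 <= L &
  forall u v, `|u| <= r -> `|v| <= r -> `|h u - h v| <= L * `|u - v|.

Lemma loclipD h g : loclip h -> loclip g -> loclip (fun u => h u + g u).
Proof.
move=> hl gl r r0; have [L L0 hL] := hl r r0; have [L' L'0 gL] := gl r r0.
exists (L + L'); first exact: addr_ge0.
move=> u v ur vr; have := hL u v ur vr; have := gL u v ur vr.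
have -> : h u + g u - (h v + g v) = (h u - h v) + (g u - g v) by lra.
move=> h1 h2; apply: (le_trans (ler_normD _ _)); lra.
Qed.

Lemma loclipZ (k : R) h : loclip h -> loclip (fun u => k * h u).
Proof.
move=> hl r r0; have [L L0 hL] := hl r r0.
exists (`|k| * L); first exact: mulr_ge0.
by move=> u v ur vr; rewrite -mulrBr normrM -mulrA ler_wpM2l// hL.
Qed.

Lemma loclip_cst (k : R) : loclip (fun=> k).
Proof. by move=> r r0; exists 0 => // u v _ _; rewrite subrr normr0 mul0r. Qed.

Lemma loclip_affine (a : R) (b : V) h : loclip h -> loclip (fun u => h (b + a *: u)).
Proof.
move=> hl r r0.
have r'0 : 0 < `|b| + `|a| * r + 1 by rewrite ltr_wpDl// addr_ge0// mulr_ge0// ltW.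
have [L L0 hL] := hl _ r'0; exists (L * `|a|); first exact: mulr_ge0.
have rb u : `|u| <= r -> `|b + a *: u| <= `|b| + `|a| * r + 1.
  move=> ur; apply: (le_trans (ler_normD _ _)); rewrite normrZ -addrA lerD2l.
  by apply: (@le_trans _ _ (`|a| * r)); [rewrite ler_wpM2l|rewrite lerDl].
move=> u v ur vr; have := hL _ _ (rb u ur) (rb v vr).
by rewrite opprD addrACA subrr add0r -scalerBr normrZ mulrA.
Qed.

Lemma loclip_dense_eq0 (C : set V) h :
  (forall u e, 0 < e -> exists2 c, C c & `|u - c| <= e) ->
  loclip h -> (forall c, C c -> h c = 0) -> forall u, h u = 0.
Proof.
move=> Cd hl hC u; have r0 : 0 < `|u| + 1 by rewrite ltr_wpDl.
have [L L0 hL] := hl _ r0.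
apply/eqP; rewrite -normr_le0; apply/ler_addgt0Pr => e e0; rewrite add0r.
have L1 : 0 < L + 1 by lra.
pose k := Num.min 1 (e / (L + 1)).
have k0 : 0 < k by rewrite lt_min ltr01 divr_gt0.
have [k1 k2] : k <= 1 /\ k <= e / (L + 1) by rewrite /k !ge_min !lexx orbT.
have [c Cc uc] := Cd u _ k0.
have ur : `|u| <= `|u| + 1 by rewrite lerDl.
have cr : `|c| <= `|u| + 1.
  rewrite -(subrK u c) addrC; apply: (le_trans (ler_normD _ _)).
  by rewrite lerD2l distrC (le_trans uc).
have := hL u c ur cr; rewrite (hC c Cc) subr0 => H; apply: (le_trans H).
apply: (@le_trans _ _ ((L + 1) * k)); first by rewrite ler_pM//; lra.
by rewrite mulrC -ler_pdivlMr.
Qed.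

Lemma linear_of_additive h : loclip h -> {morph h : u v / u + v} ->
  exists p : V, forall u, h u = (p *m u^T) ord0 ord0.
Proof.
move=> hl hD.
have h0 : h 0 = 0 by have := hD 0 0; rewrite addr0; lra.
have hZ (a : R) u : h (a *: u) = a * h u.
  have r0 : 0 < `|u| + 1 by rewrite ltr_wpDl.
  have [L L0 hL] := hl _ r0.
  have := @additive_bounded_linear _ (fun a => h (a *: u)) (L * (`|u| + 1)) _ _ a.
  rewrite scale1r; apply; first by move=> x y; rewrite scalerDl hD.
  move=> x x1; have xu : `|x *: u| <= `|u| + 1.
    by rewrite normrZ (@le_trans _ _ `|u|)// ?ler_piMl// lerDl.
  have := hL (x *: u) 0 xu; rewrite normr0 => /(_ (ltW r0)).
  rewrite h0 !subr0 => H; apply: (le_trans H).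
  by rewrite ler_wpM2l.
exists (\row_i h (delta_mx ord0 i)) => u.
have uE : u = \sum_j u ord0 j *: delta_mx ord0 j := row_sum_delta u.
rewrite {1}uE mxE.
rewrite (big_morph h hD h0); apply: eq_bigr => i _.
by rewrite hZ !mxE mulrC.
Qed.

End LocallyLipschitz.

(** * Rational directions *)

Section DenseCone.
Context {R : realType} {n : nat}.
Local Notation V := 'rV[R]_n.+1.

(** First coordinate 1 is what the lemmas on null sets along lines require; nonzero multiples of
    these directions are dense. *)
Definition rat_dir (q : 'rV[rat]_n) : V := cons_rV 1 (map_mx ratr q).

Lemma rat_dir0 q : rat_dir q ord0 ord0 = 1.
Proof. exact: cons_rV0. Qed.

Lemma rat_dir_dense (u : V) (e : R) : 0 < e ->
  exists2 c, (exists (a : R) q, a != 0 /\ c = a *: rat_dir q) & `|u - c| <= e.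
Proof.
(* A vanishing first coordinate is moved to [e], since the multiples miss that hyperplane. *)
move=> e0; pose a := if u ord0 ord0 == 0 then e else u ord0 ord0.
have a0 : a != 0 by rewrite /a; case: ifPn => // _; rewrite gt_eqF.
have ua : `|u ord0 ord0 - a| <= e.
  rewrite /a; case: ifPn => [/eqP ->|_]; last by rewrite subrr normr0 ltW.
  by rewrite sub0r normrN gtr0_norm.
have an0 : 0 < `|a| by rewrite normr_gt0.
have /choice[q qP] : forall k : 'I_n, exists q : rat,
    `|u ord0 (lift ord0 k) / a - ratr q| < e / `|a|.
  move=> k; have ea : 0 < e / `|a| by rewrite divr_gt0.
  have [|q] := @rat_in_itvoo R (u ord0 (lift ord0 k) / a - e / `|a|)
    (u ord0 (lift ord0 k) / a + e / `|a|); first by lra.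
  by rewrite in_itv/= => /andP[q1 q2]; exists q; rewrite ltr_norml; apply/andP; split; lra.
exists (a *: rat_dir (\row_k q k)); first by exists a, (\row_k q k).
apply: norm_le_coord; first exact: ltW.
have E i : (u - a *: rat_dir (\row_k q k)) ord0 i =
    u ord0 i - a * rat_dir (\row_k q k) ord0 i by rewrite !mxE.
apply: forall_ordS => [|k]; rewrite E; first by rewrite rat_dir0 mulr1.
rewrite cons_rV_lift !mxE; have := qP k; rewrite ltr_pdivlMr// -normrM mulrBl divfK//.
by rewrite [ratr _ * a]mulrC => /ltW.
Qed.

(** The resulting directions are the first basis vector and its sums with each of the others: a
    basis made of rational directions. *)
Definition rat_basis (i : 'I_n.+1) : 'rV[rat]_n :=
  \row_k (i == lift ord0 k)%:R.

Lemma rat_basis_span (u : V) : exists c : 'I_n.+1 -> R,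
  (forall i, `|c i| <= n.+1%:R * `|u|) /\ u = \sum_i c i *: rat_dir (rat_basis i).
Proof.
pose c (i : 'I_n.+1) := if i == ord0 then u ord0 ord0 - \sum_k u ord0 (lift ord0 k)
  else u ord0 i.
have cl k : c (lift ord0 k) = u ord0 (lift ord0 k) by [].
exists c; split.
  apply: forall_ordS => [|k]; last first.
    by rewrite cl (le_trans (coord_le_norm _ _))// ler_peMl// ler1n.
  rewrite /c eqxx; apply: (le_trans (ler_normB _ _)).
  rewrite -nat1r mulrDl mul1r; apply: lerD; first exact: coord_le_norm.
  apply: (le_trans (ler_norm_sum _ _ _)).
  apply: (@le_trans _ _ (\sum_(k < n) `|u|)).
    by apply: ler_sum => k _; exact: coord_le_norm.
  by rewrite sumr_const card_ord mulr_natl.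
apply/rowP => j; rewrite summxE.
under eq_bigr do rewrite mxE.
move: j; apply: forall_ordS => [|k].
  under eq_bigr do rewrite rat_dir0 mulr1.
  rewrite big_ord_recl /c eqxx.
  by under [X in _ = _ + X]eq_bigr do rewrite -/c; rewrite subrK.
under eq_bigr do rewrite cons_rV_lift !mxE.
rewrite (bigD1 (lift ord0 k))//= eqxx ratr_nat mulr1 big1 ?addr0//.
by move=> i ik; rewrite (negPf ik) ratr_nat mulr0.
Qed.

(* The first condition is the expansion to order two of [F] along the line
   [rat_dir q'] at [0], with second derivative [c]; the second one says that the
   second difference quotients in this direction are also close to [c] at points
   [s *: rat_dir q] arbitrarily close to [0]. *)
Definition expands_along_lines (F : V -> R) := forall q' (e : R), 0 < e ->
  exists c d : R, [/\ 0 < d,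
  (forall t r : R, t != 0 -> r != 0 -> `|t| <= d -> `|r| <= d ->
    `|F (t *: rat_dir q') / t - F (r *: rat_dir q') / r - c * (t - r) / 2|
      <= e * (`|t| + `|r|)) &
  (forall q (d' : R), 0 < d' ->
    exists2 s : R, 0 < s < d' & forall h : R, h != 0 -> `|h| <= d ->
    `|F (s *: rat_dir q + h *: rat_dir q') + F (s *: rat_dir q - h *: rat_dir q')
      - 2 * F (s *: rat_dir q) - c * h ^+ 2| <= 2 * e * h ^+ 2)].

End DenseCone.

(** * Expansion of order two at a point *)

Section PointwiseExpansion.
Context {R : realType} {n : nat}.
Local Notation V := 'rV[R]_n.+1.
Variable F : V -> R.
Hypothesis F_convex : convexV F.
Hypothesis F0 : F 0 = 0.
Hypothesis F_lines : expands_along_lines F.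

Let cone : set V := [set c | exists (a : R) q, a != 0 /\ c = a *: rat_dir q].

Let g1 (s : R) (u : V) := F (s *: u) / s.

Let g1Z a s u : a != 0 -> g1 s (a *: u) = a * g1 (s * a) u.
Proof.
move=> a0; rewrite /g1 scalerA.
have [->|s0] := eqVneq s 0; first by rewrite !mul0r scale0r F0 !mul0r mulr0.
by field; rewrite a0 s0.
Qed.

Let g1_lines q : exists K d : R, [/\ 0 < K, 0 < d & forall t r : R, t != 0 -> r != 0 ->
  `|t| <= d -> `|r| <= d -> `|g1 t (rat_dir q) - g1 r (rat_dir q)|
     <= K * (`|t| + `|r|)].
Proof.
have [c [d [d0 H _]]] := F_lines q ltr01.
exists (`|c| + 1), d; split=> //.
move=> t r t0 r0 td rd; have := H t r t0 r0 td rd.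
rewrite -/(g1 t _) -/(g1 r _) mul1r => {}H.
have -> : g1 t (rat_dir q) - g1 r (rat_dir q) =
  (g1 t (rat_dir q) - g1 r (rat_dir q) - c * (t - r) / 2) + c * (t - r) / 2 by lra.
apply: (le_trans (ler_normD _ _)); rewrite mulrDl mul1r addrC; apply: lerD => //.
rewrite -mulrA normrM ler_wpM2l// normrM [X in _ * X]ger0_norm//.
by have := ler_normB t r; have := normr_ge0 (t - r); lra.
Qed.

(** The limit is subadditive by convexity, and odd because the quotients for [t] and [- t] approach
    each other along rational directions; hence it is additive. *)
Lemma directional_derivative_linear : exists p : V, forall u e, 0 < e -> exists2 s0, 0 < s0 &
  forall s, 0 < s < s0 -> `|g1 s u - (p *m u^T) ord0 ord0| <= e.
Proof.
have g1_lip r : 0 < r -> exists L s0, [/\ 0 <= L, 0 < s0 &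
  forall s, 0 < s < s0 -> forall u v, `|u| <= r -> `|v| <= r ->
    `|g1 s u - g1 s v| <= L * `|u - v|].
  move=> r0; have [L [L0 FL]] := convexV_rV_lipschitz r F_convex.
  exists L, 1; split=> // s /andP[s0 s1] u v ur vr.
  have sr (w : V) : `|w| <= r -> `|s *: w| <= r.
    by move=> wr; rewrite normrZ (le_trans _ wr)// ler_piMl// gtr0_norm// ltW.
  have := FL _ _ (sr u ur) (sr v vr).
  rewrite -scalerBr normrZ mulrCA.
  rewrite /g1 -mulrBl normrM normfV (gtr0_norm s0) ler_pdivrMr//.
  by rewrite [leRHS]mulrC.
have g1_cauchy c e : cone c -> 0 < e -> exists2 s0, 0 < s0 &
    forall s s', 0 < s < s0 -> 0 < s' < s0 -> `|g1 s c - g1 s' c| <= e.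
  move=> [a [q [a0 ->]]] e0.
  have [K [d [K0 d0 H]]] := g1_lines q.
  have an : 0 < `|a| by rewrite normr_gt0.
  have aK : 0 < 2 * `|a| ^+ 2 * K by rewrite !mulr_gt0// exprn_gt0.
  exists (Num.min (d / `|a|) (e / (2 * `|a| ^+ 2 * K))).
    by rewrite lt_min !divr_gt0.
  move=> s s' /andP[s0]; rewrite lt_min ltr_pdivlMr// ltr_pdivlMr// => /andP[s1 s2].
  move=> /andP[s'0]; rewrite lt_min ltr_pdivlMr// ltr_pdivlMr// => /andP[s'1 s'2].
  rewrite !g1Z// -mulrBr normrM.
  have sa t : 0 < t -> `|t * a| = t * `|a| by move=> t0; rewrite normrM gtr0_norm.
  have := H (s * a) (s' * a) _ _ _ _; rewrite !sa// => /(_ _ _ (ltW s1) (ltW s'1)) {}H.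
  have {}H := H (mulf_neq0 (lt0r_neq0 s0) a0) (mulf_neq0 (lt0r_neq0 s'0) a0).
  apply: (le_trans (ler_wpM2l (ltW an) H)).
  by lra.
have [phi [phi_lip phi_lim]] := cauchy_family g1_lip (@rat_dir_dense R n) g1_cauchy.
have lim u e : 0 < e -> exists2 s0, 0 < s0 &
  forall s, 0 < s < s0 -> `|g1 s u - phi u| <= e.
  move=> e0; have [|s0 s00 H] := phi_lim (`|u| + 1) e _ e0; first by rewrite ltr_wpDl.
  by exists s0 => // s ss; apply: H => //; rewrite lerDl.
(* Midpoint convexity compares scale [s] for the sum with scale [2 * s] for the terms. *)
have phi_sub u v : phi (u + v) <= phi u + phi v.
  apply/ler_addgt0Pr => e e0; have e3 : 0 < e / 3 by rewrite divr_gt0.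
  have [s1 s10 H1] := lim u _ e3; have [s2 s20 H2] := lim v _ e3.
  have [s3 s30 H3] := lim (u + v) _ e3.
  pose m := Num.min s1 (Num.min s2 s3).
  have m0 : 0 < m by rewrite !lt_min s10 s20.
  have [m1 m2 m3] : [/\ m <= s1, m <= s2 & m <= s3].
    by rewrite /m; split; rewrite !ge_min lexx ?orbT.
  pose s := m / 4.
  have A1 : 0 < 2 * s < s1 by rewrite /s; apply/andP; split; lra.
  have A2 : 0 < 2 * s < s2 by rewrite /s; apply/andP; split; lra.
  have A3 : 0 < s < s3 by rewrite /s; apply/andP; split; lra.
  have s0 : 0 < s by case/andP: A3.
  have := convexV_half (s *: u) (s *: v) F_convex.
  rewrite !scalerA -scalerDr => h.
  have : g1 s (u + v) <= g1 (2 * s) u + g1 (2 * s) v.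
    rewrite /g1 ler_pdivrMr//; apply: (le_trans h).
    rewrite le_eqVlt; apply/orP; left; apply/eqP; field; lra.
  have := H1 _ A1; have := H2 _ A2; have := H3 _ A3.
  by rewrite !ler_norml => /andP[? ?] /andP[? ?] /andP[? ?]; lra.
have phi_odd u : phi u + phi (- u) = 0.
  have phi_negl : loclip (fun u => phi (- u)).
    have := loclip_affine (-1) 0 phi_lip.
    by under eq_fun do rewrite add0r scaleN1r.
  apply: (loclip_dense_eq0 (@rat_dir_dense R n) (loclipD phi_lip phi_negl)).
  move=> _ [a [q [a0 ->]]].
  have [K [d [K0 d0 H]]] := g1_lines q.
  have an : 0 < `|a| by rewrite normr_gt0.
  apply/eqP; rewrite -normr_le0; apply/ler_addgt0Pr => e e0; rewrite add0r.
  have e3 : 0 < e / 3 by rewrite divr_gt0.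
  have [s1 s10 H1] := lim (a *: rat_dir q) _ e3.
  have [s2 s20 H2] := lim (- (a *: rat_dir q)) _ e3.
  have aK : 0 < 2 * `|a| ^+ 2 * K by rewrite !mulr_gt0// exprn_gt0.
  pose m := Num.min (Num.min s1 s2) (Num.min (d / `|a|) (e / 3 / (2 * `|a| ^+ 2 * K))).
  have m0 : 0 < m by rewrite !lt_min s10 s20 !divr_gt0.
  have [m1 m2 m3 m4] : [/\ m <= s1, m <= s2, m <= d / `|a| &
      m <= e / 3 / (2 * `|a| ^+ 2 * K)].
    by rewrite /m; split; rewrite !ge_min lexx ?orbT.
  pose s := m / 2.
  have s0 : 0 < s by rewrite /s divr_gt0.
  have A1 : 0 < s < s1 by exact: half_itv.
  have A2 : 0 < s < s2 by exact: half_itv.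
  have s3 : s * `|a| <= d by rewrite -ler_pdivlMr// /s; lra.
  have s4 : s * (2 * `|a| ^+ 2 * K) <= e / 3 by rewrite -ler_pdivlMr// /s; lra.
  have B1 := H1 _ A1; have B2 := H2 _ A2.
  rewrite -scaleNr g1Z ?oppr_eq0// in B2; rewrite g1Z// in B1.
  have sa : `|s * a| = s * `|a| by rewrite normrM gtr0_norm.
  have saN : `|s * - a| = s * `|a| by rewrite normrM normrN gtr0_norm.
  have sa0 : s * a != 0 by rewrite mulf_neq0// gt_eqF.
  have saN0 : s * - a != 0 by rewrite mulf_neq0 ?oppr_eq0// gt_eqF.
  have := H _ _ sa0 saN0; rewrite sa saN => /(_ s3 s3) B3.
  have {}B3 : `|a * g1 (s * a) (rat_dir q) + - a * g1 (s * - a) (rat_dir q)| <= e / 3.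
    rewrite mulNr -mulrBr normrM; apply: (le_trans (ler_wpM2l (ltW an) B3)); lra.
  rewrite -scaleNr.
  have -> : phi (a *: rat_dir q) + phi (- a *: rat_dir q) =
    (a * g1 (s * a) (rat_dir q) + - a * g1 (s * - a) (rat_dir q)) -
    (a * g1 (s * a) (rat_dir q) - phi (a *: rat_dir q)) -
    (- a * g1 (s * - a) (rat_dir q) - phi (- a *: rat_dir q)) by lra.
  apply: (le_trans (ler_normB _ _)).
  by apply: (le_trans (lerD (ler_normB _ _) (lexx _))); lra.
have phi_add : {morph phi : u v / u + v}.
  move=> u v; apply/eqP; rewrite eq_le phi_sub/=.
  have := phi_sub (- u) (- v); rewrite -opprD.
  have := phi_odd u; have := phi_odd v; have := phi_odd (u + v); lra.
have [p pE] := linear_of_additive phi_lip phi_add.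
by exists p => u e e0; rewrite -pE; exact: lim.
Qed.

End PointwiseExpansion.

(** * Quotients of order two and their quadratic limit *)

Section SecondOrder.
Context {R : realType} {n : nat}.
Local Notation V := 'rV[R]_n.+1.
Variable F : V -> R.
Hypothesis F_convex : convexV F.
Hypothesis F0 : F 0 = 0.
Hypothesis F_lines : expands_along_lines F.
Variable p : V.
Let l (u : V) := (p *m u^T) ord0 ord0.
Hypothesis F_deriv : forall u (e : R), 0 < e -> exists2 s0, 0 < s0 &
  forall s, 0 < s < s0 -> `|F (s *: u) / s - l u| <= e.

Let lD u v : l (u + v) = l u + l v.
Proof. by rewrite /l linearD mulmxDr mxE. Qed.
Let lZ a u : l (a *: u) = a * l u.
Proof. by rewrite /l linearZ -scalemxAr mxE. Qed.

Let l0 : l 0 = 0.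
Proof. by have := lZ 0 0; rewrite scale0r mul0r. Qed.

Let G (s : R) (u : V) := (F (s *: u) / s - l u) / s.

Let GZ a s u : a != 0 -> G s (a *: u) = a ^+ 2 * G (s * a) u.
Proof.
move=> a0; rewrite /G scalerA lZ.
have [->|s0] := eqVneq s 0; first by rewrite !mul0r invr0 !mulr0.
by field; rewrite a0 s0.
Qed.

Let G_convex s : 0 < s -> convexV (G s).
Proof.
move=> s0 x y t t01; rewrite /G lD !lZ scalerDr !scalerA ![s * _]mulrC -!scalerA.
have := F_convex (s *: x) (s *: y) t01 => h.
have -> : t * ((F (s *: x) / s - l x) / s) + (1 - t) * ((F (s *: y) / s - l y) / s) =
  ((t * F (s *: x) + (1 - t) * F (s *: y)) / s - (t * l x + (1 - t) * l y)) / s.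
  by field; rewrite gt_eqF.
by rewrite !ler_pM2r ?invr_gt0// lerD2r ler_pM2r ?invr_gt0.
Qed.

Let G0 s : G s 0 = 0.
Proof. by rewrite /G scaler0 F0 mul0r l0 subrr mul0r. Qed.

(** Let the second increment in [F_lines] tend to 0: its first-order quotient tends to
    [l (rat_dir q)], which leaves a bound on [G t] alone. *)
Let G_lines q (e : R) : 0 < e -> exists c d : R, [/\ 0 < d,
  (forall t, t != 0 -> `|t| <= d -> `|G t (rat_dir q) - c / 2| <= e) &
  (forall q' (d' : R), 0 < d' -> exists2 s : R, 0 < s < d' & forall h : R, h != 0 -> `|h| <= d ->
    `|F (s *: rat_dir q' + h *: rat_dir q) + F (s *: rat_dir q' - h *: rat_dir q)
      - 2 * F (s *: rat_dir q') - c * h ^+ 2| <= 2 * e * h ^+ 2)].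
Proof.
move=> e0; have [c [d [d0 H1 H2]]] := F_lines q e0.
exists c, d; split=> // t t0 td.
have tn : 0 < `|t| by rewrite normr_gt0.
rewrite -(ler_pM2r tn) -normrM mulrBl /G divfK//.
have -> : F (t *: rat_dir q) / t - l (rat_dir q) - c / 2 * t =
  F (t *: rat_dir q) / t - l (rat_dir q) - c * t / 2 by lra.
apply/ler_addgt0Pr => k k0.
have k3 : 0 < k / 3 by rewrite divr_gt0.
have [s0 s00 H3] := F_deriv (rat_dir q) k3.
have c1 : 0 < `|c| + 1 by rewrite ltr_wpDl.
pose m := Num.min (Num.min s0 d) (Num.min (k / 3 / e) (k / 3 / (`|c| + 1))).
have m0 : 0 < m by rewrite !lt_min s00 d0 !divr_gt0.
have [m1 m2 m3 m4] : [/\ m <= s0, m <= d, m <= k / 3 / e & m <= k / 3 / (`|c| + 1)].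
  by rewrite /m; split; rewrite !ge_min lexx ?orbT.
pose s := m / 2.
have sp : 0 < s by rewrite /s divr_gt0.
have A1 : 0 < s < s0 by exact: half_itv.
have s3 : e * s <= k / 3 by rewrite mulrC -ler_pdivlMr// /s; lra.
have s4 : `|c * s / 2| <= k / 3.
  rewrite -mulrA normrM [X in _ * X]gtr0_norm ?divr_gt0//.
  move: m4; rewrite ler_pdivlMr// => m4.
  have : `|c| * (s / 2) <= (`|c| + 1) * m by rewrite ler_pM// /s; lra.
  by lra.
have sn : `|s| = s by rewrite gtr0_norm.
have sd : `|s| <= d by rewrite sn /s; lra.
have B1 := H1 t s t0 (lt0r_neq0 sp) td sd; have B2 := H3 _ A1.
rewrite sn in B1.
have -> : F (t *: rat_dir q) / t - l (rat_dir q) - c * t / 2 =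
  (F (t *: rat_dir q) / t - F (s *: rat_dir q) / s - c * (t - s) / 2) +
  (F (s *: rat_dir q) / s - l (rat_dir q)) - c * s / 2 by lra.
apply: (le_trans (ler_normB _ _)).
by apply: (le_trans (lerD (ler_normD _ _) (lexx _))); lra.
Qed.

(** Bounds uniform in [s] come from finitely many directions: [G_lines] controls the multiples of a
    basis, and convexity extends this to balls and to Lipschitz constants. *)
Let G_lip r : 0 < r -> exists L s0, [/\ 0 <= L, 0 < s0 &
  forall s, 0 < s < s0 -> forall u v, `|u| <= r -> `|v| <= r ->
    `|G s u - G s v| <= L * `|u - v|].
Proof.
move=> r0.
(* [rho] bounds the coefficients in [rat_basis] of points of norm at most [r + 1], and [A] the
   multiples on which [convexV_bound] evaluates; adding 1 makes [A] at least 1. *)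
pose rho := n.+1%:R * (r + 1).
pose A := rho * 2 ^+ size (enum 'I_n.+1) + 1.
have A1 : 1 <= A by rewrite /A lerDr mulr_ge0 ?exprn_ge0// mulr_ge0//; lra.
have /choice[cd cdP] : forall i : 'I_n.+1, exists cd : R * R, 0 < cd.2 /\
    forall t, t != 0 -> `|t| <= cd.2 -> `|G t (rat_dir (rat_basis i)) - cd.1 / 2| <= 1.
  move=> i; have [c [d [d0 H _]]] := G_lines (rat_basis i) ltr01.
  by exists (c, d).
have Ai i : 0 <= A ^+ 2 * (`|(cd i).1| / 2 + 1).
  apply: mulr_ge0; first by apply: exprn_ge0; lra.
  by apply: addr_ge0 => //; exact: divr_ge0.
pose M := \sum_i A ^+ 2 * (`|(cd i).1| / 2 + 1).
have M1 i : A ^+ 2 * (`|(cd i).1| / 2 + 1) <= M.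
  by rewrite /M (bigD1 i)//= lerDl sumr_ge0// => j _; exact: Ai.
have M0 : 0 <= M by apply: le_trans (M1 ord0).
(* Below [s0], the increments [s * a] with [|a| <= A] are in the range of every basis direction. *)
pose s0 := \big[Num.min/1]_i ((cd i).2 / A).
have s00 : 0 < s0.
  by apply: lt_bigmin => // i _; rewrite divr_gt0//; [case: (cdP i)|lra].
have s0i i : s0 <= (cd i).2 / A by exact: bigmin_le_cond.
exists (2 * M), s0; split=> //; first by rewrite mulr_ge0.
move=> s /andP[sp ss] u v ur vr.
apply: (convexV_lipschitz (G_convex sp) _ ur vr).
apply: (convexV_norm_bound (G_convex sp) (G0 s)) => x xr.
have [c [cb ->]] := rat_basis_span x.
rewrite -big_enum/=.
apply: (@convexV_bound _ _ (G s) _ (enum 'I_n.+1) (fun i => rat_dir (rat_basis i)) c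
  rho M (G_convex sp)); first by rewrite G0.
- move=> i a _ aA.
  have [->|a0] := eqVneq a 0; first by rewrite scale0r G0.
  have {}aA : `|a| <= A by rewrite /A; lra.
  rewrite GZ//; apply: le_trans (M1 i).
  have [d0 H] := cdP i.
  have sa : s * a != 0 by rewrite mulf_neq0// gt_eqF.
  have sad : `|s * a| <= (cd i).2.
    rewrite normrM gtr0_norm//; have := s0i i; rewrite ler_pdivlMr; last by lra.
    have : s * `|a| <= s0 * A by rewrite ler_pM//; lra.
    by lra.
  have := H _ sa sad; rewrite ler_norml => /andP[_ h].
  have h' : G (s * a) (rat_dir (rat_basis i)) <= `|(cd i).1| / 2 + 1.
    by have := ler_norm (cd i).1; lra.
  have aA2 : a ^+ 2 <= A ^+ 2 by rewrite -real_normK ?num_real// lerXn2r// ?nnegrE; lra.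
  apply: (@le_trans _ _ (a ^+ 2 * (`|(cd i).1| / 2 + 1))).
    by rewrite ler_wpM2l// sqr_ge0.
  by apply: ler_wpM2r => //; apply: addr_ge0 => //; exact: divr_ge0.
- move=> i _; apply: (le_trans (cb i)).
  by rewrite /rho ler_wpM2l.
Qed.

Let cone : set V := [set c | exists (a : R) q, a != 0 /\ c = a *: rat_dir q].

(** Both signs of [s] are allowed, so [c] and [- c] share the same limit; this makes [phi] even on
    the cone. *)
Let G_cone c (e : R) : cone c -> 0 < e -> exists k s0 : R, 0 < s0 /\
  forall s, s != 0 -> `|s| < s0 -> `|G s c - k| <= e.
Proof.
move=> [a [q [a0 ->]]] e0.
have a2 : 0 < a ^+ 2 by rewrite exprn_even_gt0.
have ea : 0 < e / a ^+ 2 by rewrite divr_gt0.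
have [c' [d [d0 H _]]] := G_lines q ea.
have an : 0 < `|a| by rewrite normr_gt0.
exists (a ^+ 2 * (c' / 2)), (d / `|a|); split; first by rewrite divr_gt0.
move=> s s0; rewrite ltr_pdivlMr// => sd.
rewrite GZ// -mulrBr normrM gtr0_norm//.
have sa : s * a != 0 by rewrite mulf_neq0.
have := H _ sa; rewrite normrM => /(_ (ltW sd)).
by rewrite ler_pdivlMr// mulrC.
Qed.

Let G_cauchy c e : cone c -> 0 < e -> exists2 s0, 0 < s0 &
  forall s s', 0 < s < s0 -> 0 < s' < s0 -> `|G s c - G s' c| <= e.
Proof.
move=> Cc e0; have e2 : 0 < e / 2 by rewrite divr_gt0.
have [k [s0 [s00 H]]] := G_cone Cc e2.
exists s0 => // s s' /andP[sp ss] /andP[sp' ss'].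
have := H s (lt0r_neq0 sp); rewrite gtr0_norm// => /(_ ss) h1.
have := H s' (lt0r_neq0 sp'); rewrite gtr0_norm// => /(_ ss') h2.
have -> : G s c - G s' c = (G s c - k) - (G s' c - k) by lra.
by apply: (le_trans (ler_normB _ _)); lra.
Qed.

Let quad_limit : exists phi : V -> R, loclip phi /\
  (forall r e, 0 < r -> 0 < e -> exists2 s0, 0 < s0 &
    forall s u, 0 < s < s0 -> `|u| <= r -> `|G s u - phi u| <= e).
Proof. exact: (cauchy_family G_lip (@rat_dir_dense R n) G_cauchy). Qed.

Lemma second_order_expansion : exists H : 'M[R]_n.+1, H \is symmetricmx /\
  forall e, 0 < e -> exists2 d, 0 < d & forall u, `|u| <= d ->
    `|F u - (l u + 2^-1 * (u *m H *m u^T) ord0 ord0)| <= e * `|u| ^+ 2.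
Proof.
have [phi [phi_lip phi_lim]] := quad_limit.
have lim u e : 0 < e -> exists2 s0, 0 < s0 &
  forall s, 0 < s < s0 -> `|G s u - phi u| <= e.
  move=> e0; have [|s0 s00 H] := phi_lim (`|u| + 1) e _ e0; first by rewrite ltr_wpDl.
  by exists s0 => // s ss; apply: H => //; rewrite lerDl.
have phi0 : phi 0 = 0.
  apply/eqP; rewrite -normr_le0; apply/ler_addgt0Pr => e e0; rewrite add0r.
  have [s0 s00 H] := lim 0 _ e0; have := H (s0 / 2); rewrite G0 sub0r normrN; apply.
  by apply/andP; split; lra.
have phiZp (a : R) u : 0 < a -> phi (a *: u) = a ^+ 2 * phi u.
  move=> a0; apply/eqP; rewrite -subr_eq0 -normr_le0; apply/ler_addgt0Pr => e e0.
  rewrite add0r.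
  have a2 : 0 < a ^+ 2 by rewrite exprn_gt0.
  have e2 : 0 < e / 2 by rewrite divr_gt0.
  have e2a : 0 < e / 2 / a ^+ 2 by rewrite divr_gt0.
  have [s1 s10 H1] := lim (a *: u) _ e2; have [s2 s20 H2] := lim u _ e2a.
  pose m := Num.min s1 (s2 / a).
  have m0 : 0 < m by rewrite !lt_min s10 divr_gt0.
  have [m1 m2] : m <= s1 /\ m <= s2 / a by rewrite /m !ge_min !lexx orbT.
  have A1 : 0 < m / 2 < s1 by exact: half_itv.
  have A2 : 0 < m / 2 * a < s2.
    rewrite ler_pdivlMr// in m2.
    have ma : 0 < m * a by rewrite mulr_gt0.
    by apply/andP; split; lra.
  have B1 := H1 _ A1; have := H2 _ A2; rewrite ler_pdivlMr// => B2.
  rewrite GZ ?gt_eqF// in B1.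
  have B3 : `|a ^+ 2 * (G (m / 2 * a) u - phi u)| <= e / 2.
    by rewrite normrM gtr0_norm// mulrC.
  have -> : phi (a *: u) - a ^+ 2 * phi u = a ^+ 2 * (G (m / 2 * a) u - phi u) -
    (a ^+ 2 * G (m / 2 * a) u - phi (a *: u)) by lra.
  by apply: (le_trans (ler_normB _ _)); lra.
have phiN u : phi (- u) = phi u.
  have phiNl : loclip (fun u => phi (- u)).
    have := loclip_affine (-1) 0 phi_lip.
    by under eq_fun do rewrite add0r scaleN1r.
  suff : phi (- u) + -1 * phi u = 0 by lra.
  apply: (loclip_dense_eq0 (h := fun u => phi (- u) + -1 * phi u) (@rat_dir_dense R n)).
    by apply: loclipD => //; exact: loclipZ.
  move=> c Cc; apply/eqP; rewrite -normr_le0; apply/ler_addgt0Pr => e e0; rewrite add0r.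
  have e4 : 0 < e / 4 by rewrite divr_gt0.
  have [k [s0 [s00 H]]] := G_cone Cc e4.
  have [s1 s10 H1] := lim c _ e4; have [s2 s20 H2] := lim (- c) _ e4.
  pose m := Num.min s0 (Num.min s1 s2).
  have m0 : 0 < m by rewrite !lt_min s00 s10.
  have [m1 m2 m3] : [/\ m <= s0, m <= s1 & m <= s2].
    by rewrite /m; split; rewrite !ge_min lexx ?orbT.
  pose s := m / 2.
  have sp : 0 < s by rewrite /s; lra.
  have A1 : 0 < s < s1 by exact: half_itv.
  have A2 : 0 < s < s2 by exact: half_itv.
  have ss0 : `|s| < s0 by rewrite gtr0_norm// /s; lra.
  have sN0 : - s != 0 by rewrite oppr_eq0 gt_eqF.
  have sNs : `|- s| < s0 by rewrite normrN.
  have B1 := H _ (lt0r_neq0 sp) ss0; have B2 := H _ sN0 sNs.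
  have B3 := H1 _ A1; have B4 := H2 _ A2.
  rewrite -scaleN1r GZ ?oppr_eq0 ?oner_eq0// sqrrN expr1n mul1r mulrN1 in B4.
  rewrite -scaleN1r.
  have -> : phi (-1 *: c) + -1 * phi c = (G (- s) c - k) - (G s c - k) +
     ((G s c - phi c) - (G (- s) c - phi (-1 *: c))) by lra.
  apply: (le_trans (ler_normD _ _)).
  apply: (le_trans (lerD (ler_normB _ _) (ler_normB _ _))); lra.
have phiZ (a : R) u : phi (a *: u) = a ^+ 2 * phi u.
  have [a0|a0|->] := ltgtP a 0; last by rewrite scale0r phi0 expr0n/= mul0r.
    by rewrite -[a]opprK scaleNr phiN phiZp ?sqrrN//; lra.
  exact: phiZp.
(* The second difference of [G s] at [v] is that of [F] at [s v] over [s^2], as [l] cancels. For [s]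
   from the last clause of [G_lines] it is close to [a^2 c], and so is [2 * G s (a w)] by the clause
   before; the limit is the parallelogram law. *)
have par1 q q' (a : R) : a != 0 ->
    phi (rat_dir q + a *: rat_dir q') + phi (rat_dir q - a *: rat_dir q') -
    2 * phi (rat_dir q) - 2 * phi (a *: rat_dir q') = 0.
  move=> a0; set v := rat_dir q; set w := rat_dir q'.
  have a2 : 0 < a ^+ 2 by rewrite exprn_even_gt0.
  have an : 0 < `|a| by rewrite normr_gt0.
  apply/eqP; rewrite -normr_le0; apply/ler_addgt0Pr => e e0; rewrite add0r.
  (* The final sum has ten errors [e1]: two in [B5], one each in [B1] and [B2], two each from [B3],
     [B4] and [B6]. *)
  pose e1 := e / 10; have e10 : 0 < e1 by rewrite divr_gt0.
  pose e2 := e1 / a ^+ 2; have e20 : 0 < e2 by rewrite divr_gt0.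
  have e2E : a ^+ 2 * e2 = e1 by rewrite /e2 mulrC divfK// gt_eqF.
  have [c [d [d0 H1 H2]]] := G_lines q' e20.
  have [s1 s10 L1] := lim (v + a *: w) _ e10; have [s2 s20 L2] := lim (v - a *: w) _ e10.
  have [s3 s30 L3] := lim v _ e10; have [s4 s40 L4] := lim (a *: w) _ e10.
  pose m := Num.min (Num.min (Num.min s1 s2) (Num.min s3 s4)) (d / `|a|).
  have m0 : 0 < m by rewrite !lt_min s10 s20 s30 s40 divr_gt0.
  have [m1 m2 m3 m4] : [/\ m <= s1, m <= s2, m <= s3 & m <= s4].
    by rewrite /m; split; rewrite !ge_min lexx ?orbT.
  have m5 : m <= d / `|a| by rewrite /m !ge_min lexx ?orbT.
  have [s /andP[s0 sm] S2] := H2 q _ m0.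
  have sI s' : m <= s' -> 0 < s < s' by move=> h; rewrite s0 (lt_le_trans sm).
  have B1 := L1 _ (sI _ m1); have B2 := L2 _ (sI _ m2).
  have B3 := L3 _ (sI _ m3); have B4 := L4 _ (sI _ m4).
  have sa0 : s * a != 0 by rewrite mulf_neq0// gt_eqF.
  have sad : `|s * a| <= d.
    by rewrite normrM gtr0_norm// -ler_pdivlMr// ltW// (lt_le_trans sm).
  have {}S2 := S2 _ sa0 sad; rewrite -/v -/w in S2.
  have B5 : `|G s (v + a *: w) + G s (v - a *: w) - 2 * G s v - a ^+ 2 * c| <= 2 * e1.
    have -> : G s (v + a *: w) + G s (v - a *: w) - 2 * G s v - a ^+ 2 * c =
      (F (s *: v + (s * a) *: w) + F (s *: v - (s * a) *: w) - 2 * F (s *: v) -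
       c * (s * a) ^+ 2) / s ^+ 2.
      rewrite /G -scaleNr !lD !lZ !scalerDr !scalerA mulrN scaleNr.
      by field; rewrite gt_eqF.
    rewrite normrM normfV (gtr0_norm (exprn_gt0 2 s0)) ler_pdivrMr ?exprn_gt0//.
    apply: (le_trans S2); rewrite le_eqVlt; apply/orP; left; apply/eqP.
    by rewrite -e2E; ring.
  have := H1 _ sa0 sad; rewrite -/w => B6.
  have {}B6 : `|G s (a *: w) - a ^+ 2 * c / 2| <= e1.
    rewrite GZ// -mulrA -mulrBr normrM gtr0_norm// -e2E.
    by rewrite ler_wpM2l// ltW.
  have -> : phi (v + a *: w) + phi (v - a *: w) - 2 * phi v - 2 * phi (a *: w) =
    (G s (v + a *: w) + G s (v - a *: w) - 2 * G s v - a ^+ 2 * c) -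
    (G s (v + a *: w) - phi (v + a *: w)) - (G s (v - a *: w) - phi (v - a *: w)) +
    (2 * (G s v - phi v) + 2 * (G s (a *: w) - phi (a *: w)) -
     2 * (G s (a *: w) - a ^+ 2 * c / 2)) by lra.
  apply: (le_trans (ler_normD _ _)).
  apply: (le_trans (lerD (ler_normB _ _) (ler_normB _ _))).
  apply: (le_trans (lerD (lerD (ler_normB _ _) (lexx _)) (lerD (ler_normD _ _) (lexx _)))).
  rewrite !normrM !(ger0_norm (ler0n _ 2)).
  by rewrite /e1 in B1 B2 B3 B4 B5 B6 *; lra.
have par2 u w : cone u -> cone w ->
    phi (u + w) + phi (u - w) - 2 * phi u - 2 * phi w = 0.
  move=> [b [q [b0 ->]]] [a [q' [a0 ->]]].
  have ab0 : a / b != 0 by rewrite mulf_neq0// invr_neq0.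
  have E : a *: rat_dir q' = b *: ((a / b) *: rat_dir q') :> V.
    by rewrite scalerA mulrC divfK.
  rewrite E -scalerDr -scalerBr !(phiZ b).
  have := par1 q q' _ ab0 => H.
  have -> : b ^+ 2 * phi (rat_dir q + (a / b) *: rat_dir q') +
    b ^+ 2 * phi (rat_dir q - (a / b) *: rat_dir q') - 2 * (b ^+ 2 * phi (rat_dir q)) -
    2 * (b ^+ 2 * phi ((a / b) *: rat_dir q')) = b ^+ 2 *
    (phi (rat_dir q + (a / b) *: rat_dir q') + phi (rat_dir q - (a / b) *: rat_dir q') -
    2 * phi (rat_dir q) - 2 * phi ((a / b) *: rat_dir q')) by ring.
  by rewrite H mulr0.
(* The law extends from the cone by density, one variable at a time, its defect being locally
   Lipschitz in each. *)
have trl (b : V) (k : R) : loclip (fun u => phi (b + k *: u)) by exact: loclip_affine.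
have par3 u w : cone w -> phi (u + w) + phi (u - w) - 2 * phi u - 2 * phi w = 0.
  move=> Cw.
  have := @loclip_dense_eq0 R n.+1 cone (fun u => phi (w + 1 *: u) + phi (- w + 1 *: u) +
    (-2) * phi u + - (2 * phi w)) (@rat_dir_dense R n) _ _ u.
  rewrite scale1r [w + u]addrC [- w + u]addrC => H.
  rewrite -[RHS]H; first by lra.
    apply: loclipD; last exact: loclip_cst.
    by apply: loclipD; [exact: loclipD|exact: loclipZ].
  move=> c Cc; rewrite !scale1r [w + c]addrC [- w + c]addrC.
  by rewrite -[RHS](par2 c w Cc Cw); lra.
have par u w : phi (u + w) + phi (u - w) = 2 * phi u + 2 * phi w.
  have := @loclip_dense_eq0 R n.+1 cone (fun w => phi (u + 1 *: w) + phi (u + -1 *: w) +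
    (-2) * phi w + - (2 * phi u)) (@rat_dir_dense R n) _ _ w.
  rewrite scale1r scaleN1r => H.
  have {}H := H _ _; suff : phi (u + w) + phi (u - w) + -2 * phi w - 2 * phi u = 0 by lra.
  apply: H.
    apply: loclipD; last exact: loclip_cst.
    by apply: loclipD; [exact: loclipD|exact: loclipZ].
  move=> c Cc; rewrite scale1r scaleN1r.
  by rewrite -[RHS](par3 u c Cc); lra.
have phi_bounded r : exists M, forall u, `|u| <= r -> `|phi u| <= M.
  have [r0|r0] := ltP r 0.
    by exists 0 => u ur; have := le_lt_trans ur r0; rewrite ltNge normr_ge0.
  have r1 : 0 < r + 1 by lra.
  have [L L0 phiL] := phi_lip _ r1.
  exists (L * (r + 1)) => u ur.
  have ur1 : `|u| <= r + 1 by lra.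
  have := phiL u 0 ur1; rewrite normr0 phi0 !subr0 => /(_ (ltW r1)) h.
  by apply: (le_trans h); rewrite ler_wpM2l.
have [H [Hsym phiE]] := quadratic_form phi_bounded phiZ par.
exists H; split=> // e e0.
(* Uniformity on the unit ball turns the limit into an expansion: the scale is [|u|] and the point
   is [u / |u|]. *)
have [s0 s00 H0] := phi_lim 1 e ltr01 e0.
exists (s0 / 2); first by rewrite divr_gt0.
move=> u us; rewrite -phiE.
have [->|u0] := eqVneq u 0.
  by rewrite F0 phi0 l0 addr0 subrr !normr0 expr0n/= mulr0.
have un : 0 < `|u| by rewrite normr_gt0.
pose v := `|u|^-1 *: u.
have vn : `|v| <= 1 by rewrite normrZ normfV normr_id mulVf// gt_eqF.
have uv : `|u| *: v = u by rewrite scalerA divff ?scale1r// gt_eqF.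
have sI : 0 < `|u| < s0 by rewrite un; lra.
have := H0 _ v sI vn.
have -> : G `|u| v - phi v = (F u - (l u + phi u)) / `|u| ^+ 2.
  rewrite /G uv; have -> : l v = l u / `|u| by rewrite lZ mulrC.
  have -> : phi v = phi u / `|u| ^+ 2 by rewrite phiZ exprVn mulrC.
  by field; rewrite gt_eqF.
by rewrite normrM normfV (gtr0_norm (exprn_gt0 2 un)) ler_pdivrMr// exprn_gt0.
Qed.

End SecondOrder.

(** * Aleksandrov's theorem *)

Section Aleksandrov.
Context {R : realType}.

Lemma near_rV (d : nat) (x : 'rV[R]_d) (P : set 'rV[R]_d) (e : R) : 0 < e ->
  (forall u, `|u| <= e -> P (x + u)) -> nbhs x P.
Proof.
move=> e0 H; apply/(@nbhs_normP R 'rV[R]_d x); exists e => //= y xy.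
rewrite -(subrK x y) addrC; apply: H.
by rewrite distrC ltW.
Qed.

Lemma twice_differentiable_atP (d : nat) (f : 'rV[R]_d -> R) x :
  twice_differentiable_at f x <-> exists (p : 'rV[R]_d) (H : 'M[R]_d),
    H \is symmetricmx /\ forall e : R, 0 < e -> exists2 s : R, 0 < s &
      forall u, `|u| <= s -> `|f (x + u) - (f x + (p *m u^T) ord0 ord0
         + 2^-1 * (u *m H *m u^T) ord0 ord0)| <= e * `|u| ^+ 2.
Proof.
split=> -[p [H [Hs E]]]; exists p, H; split=> //.
  move=> e e0; move/eqoP: E => /(_ e e0).
  move=> /(@nbhs_normP R 'rV[R]_d 0)[s /= s0 sE].
  exists (s / 2); first by rewrite divr_gt0.
  move=> u us; have := sE u; rewrite /= sub0r normrN => /(_ _).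
  rewrite [in X in _ <= _ * X]ger0_norm ?exprn_ge0//; apply.
  by lra.
apply/eqoP => e e0; have [s s0 sE] := E e e0.
apply: (near_rV s0) => u us.
rewrite add0r /= [in X in _ <= _ * X]ger0_norm ?exprn_ge0//.
exact: sE.
Qed.

Lemma twice_differentiable_atB (d : nat) (f g : 'rV[R]_d -> R) x :
  twice_differentiable_at f x -> twice_differentiable_at g x ->
  twice_differentiable_at (fun y => f y - g y) x.
Proof.
move=> /twice_differentiable_atP[p [H [Hs E]]].
move=> /twice_differentiable_atP[p' [H' [Hs' E']]].
apply/twice_differentiable_atP; exists (p - p'), (H - H'); split.
  move: Hs Hs'; rewrite !qualifE/= !expr0 !scale1r => /eqP {2}-> /eqP {2}->.
  by apply/eqP/matrixP => i j; rewrite !mxE.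
move=> e e0; have e2 : 0 < e / 2 by rewrite divr_gt0.
have [s s0 sE] := E _ e2; have [s' s'0 sE'] := E' _ e2.
exists (Num.min s s'); first by rewrite lt_min s0.
move=> u; rewrite le_min => /andP[us us'].
have := sE u us; have := sE' u us'.
have -> : ((p - p') *m u^T) ord0 ord0 = (p *m u^T) ord0 ord0 - (p' *m u^T) ord0 ord0.
  by rewrite mulmxBl !mxE.
have -> : (u *m (H - H') *m u^T) ord0 ord0 =
    (u *m H *m u^T) ord0 ord0 - (u *m H' *m u^T) ord0 ord0.
  by rewrite mulmxBr mulmxBl !mxE.
set a := (p *m _) _ _; set a' := (p' *m _) _ _.
set b := (u *m H *m _) _ _; set b' := (u *m H' *m _) _ _.
move=> h1 h2.
have -> : f (x + u) - g (x + u) - (f x - g x + (a - a') + 2^-1 * (b - b')) =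
  (f (x + u) - (f x + a + 2^-1 * b)) - (g (x + u) - (g x + a' + 2^-1 * b')) by ring.
by apply: (le_trans (ler_normB _ _)); lra.
Qed.

Lemma convex_twice_differentiable_at (n : nat) (f : 'rV[R]_n.+1 -> R) x : convexV f ->
  (forall q m, exists k j, expansion f (rat_dir q) m k j x) ->
  (forall q q' m k j, expansion f (rat_dir q') m k j x -> forall d : R, 0 < d ->
    exists2 s : R, 0 < s < d & expansion f (rat_dir q') m k j (x + s *: rat_dir q)) ->
  twice_differentiable_at f x.
Proof.
move=> cf H1 H2.
pose F u := f (x + u) - f x.
have cF : convexV F.
  move=> u v t t01; rewrite /F.
  have := cf (x + u) (x + v) t t01.
  have -> : t *: (x + u) + (1 - t) *: (x + v) = x + (t *: u + (1 - t) *: v).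
    rewrite !scalerDr addrACA -scalerDl (_ : t + (1 - t) = 1) ?scale1r//; lra.
  by lra.
have F0 : F 0 = 0 by rewrite /F addr0 subrr.
have F_lines : expands_along_lines F.
  move=> q' e e0.
  have [m me] : exists m : nat, m.+1%:R^-1 <= e.
    exists (Num.truncn e^-1); rewrite invf_ple ?posrE//.
    by rewrite ltW// truncnS_gt.
  have [k [j E]] := H1 q' m.
  exists (k%:R / m.+1%:R), j.+1%:R^-1; split; first by rewrite invr_gt0.
    move=> t r t0 r0 td rd; have := E t r t0 r0 td rd.
    rewrite /slope1 !add0r scale0r addr0 => h; apply: (le_trans h).
    by rewrite ler_wpM2r// addr_ge0.
  move=> q d' d'0; have [s sd Es] := H2 q q' m k j E d' d'0.
  exists s => // h h0 hd.
  have hN0 : - h != 0 by rewrite oppr_eq0.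
  have := Es h (- h) h0 hN0 hd; rewrite normrN => /(_ hd).
  rewrite /slope1 !add0r scale0r addr0 scaleNr => {}Es.
  have hn : 0 < `|h| by rewrite normr_gt0.
  rewrite /F (addrA x (s *: rat_dir q) (h *: rat_dir q')).
  rewrite (addrA x (s *: rat_dir q) (- (h *: rat_dir q'))).
  set A := f (x + s *: rat_dir q + h *: rat_dir q') in Es *.
  set B := f (x + s *: rat_dir q - h *: rat_dir q') in Es *.
  set C := f (x + s *: rat_dir q) in Es *.
  (* Comparing the quotients for [h] and [- h] and multiplying by [h] produces the second
     difference. *)
  have -> : A - f x + (B - f x) - 2 * (C - f x) - k%:R / m.+1%:R * h ^+ 2 =
     h * ((A - C) / h - (B - C) / - h - k%:R / m.+1%:R * (h - - h) / 2).
    by field; rewrite h0 nat1r pnatr_eq0.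
  rewrite normrM -(real_normK (num_real h)).
  apply: (le_trans (ler_wpM2l (ltW hn) Es)).
  have : m.+1%:R^-1 * `|h| ^+ 2 <= e * `|h| ^+ 2 by rewrite ler_wpM2r// exprn_ge0.
  by move: (m.+1%:R^-1 : R) => b; lra.
have [p pE] := directional_derivative_linear cF F0 F_lines.
have [H [Hs HE]] := second_order_expansion cF F0 F_lines pE.
apply/twice_differentiable_atP; exists p, H; split=> // e e0.
have [s s0 sE] := HE e e0; exists s => // u us.
have := sE u us; rewrite /F.
by have -> : f (x + u) - f x - ((p *m u^T) ord0 ord0 + 2^-1 * (u *m H *m u^T) ord0 ord0) =
  f (x + u) - (f x + (p *m u^T) ord0 ord0 + 2^-1 * (u *m H *m u^T) ord0 ord0) by ring.
Qed.

Lemma lebesgue_outer_null_countable (d : nat) (I : countType) (F : I -> set 'rV[R]_d) :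
  (forall i, lebesgue_outer R d (F i) = 0%E) ->
  lebesgue_outer R d (\bigcup_i F i) = 0%E.
Proof.
move=> F0.
pose G k := if choice.unpickle k is Some i then F i else set0.
apply/eqP; rewrite eq_le lebesgue_outer_ge0 andbT.
apply: (@le_trans _ _ (lebesgue_outer R d (\bigcup_k G k))).
  apply: le_lebesgue_outer => x [i _ Fx]; exists (choice.pickle i); first by [].
  by rewrite /G choice.pickleK.
rewrite lebesgue_outer_null_bigcup// => k; rewrite /G.
by case: choice.unpickle => [i|]; [exact: F0|exact: lebesgue_outer0].
Qed.

(** A set of outer measure zero satisfies the Caratheodory condition by monotonicity, so [N] itself
    is a measurable null set. *)
Lemma ae_of_null (d : nat) (P : 'rV[R]_d -> Prop) (N : set 'rV[R]_d) :
  lebesgue_outer R d N = 0%E -> (forall x, ~ N x -> P x) ->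
  \forall x \ae lebesgue_measure_rV R d, P x.
Proof.
move=> N0 NP; exists N; split => //.
  apply: le_caratheodory_measurable => X.
  rewrite [X in (X + _)%E](_ : _ = 0%E) ?add0e.
    by apply: le_lebesgue_outer; exact: subIsetl.
  apply/eqP; rewrite eq_le lebesgue_outer_ge0 andbT -N0.
  by apply: le_lebesgue_outer; exact: subIsetr.
by move=> x /= nPx; apply: contrapT => /NP.
Qed.

Lemma twice_differentiable_at0 (f : 'rV[R]_0 -> R) x : twice_differentiable_at f x.
Proof.
apply/twice_differentiable_atP; exists 0, 0; split.
  by rewrite qualifE/= expr0 scale1r; apply/eqP/matrixP => -[].
move=> e e0; exists 1 => // u _.
have -> : u = 0 by apply/rowP => -[].
by rewrite addr0 trmx0 mulmx0 mulmx0 !mxE mulr0 !addr0 subrr !normr0 expr0n/= mulr0.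
Qed.

Lemma aleksandrov_null (d : nat) (f : 'rV[R]_d -> R) : convexV f ->
  exists2 N, lebesgue_outer R d N = 0%E &
    forall x, ~ N x -> twice_differentiable_at f x.
Proof.
(* Rational directions need a first coordinate, so dimension 0 is treated apart. *)
case: d f => [|n] f cf.
  exists set0; first exact: lebesgue_outer0.
  by move=> x _; exact: twice_differentiable_at0.
pose N1 (i : 'rV[rat]_n * nat) :=
  [set x | ~ exists k j, expansion f (rat_dir i.1) i.2 k j x].
pose K (i : 'rV[rat]_n * nat * nat * nat) := expansion f (rat_dir i.1.1.1) i.1.1.2 i.1.2 i.2.
(* Nearby points must lie in the same [K] as [x], that is, share its approximate second derivative
   and its range of increments. *)
pose N2 (i : 'rV[rat]_n * nat * nat * nat * 'rV[rat]_n) :=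
  [set x | K i.1 x /\ exists2 d : R, 0 < d & forall s, 0 < s < d ->
    ~ K i.1 (x + s *: rat_dir i.2)].
exists (\bigcup_i N1 i `|` \bigcup_i N2 i).
  apply/eqP; rewrite eq_le lebesgue_outer_ge0 andbT.
  apply: (le_trans (outer_measureU2 (lebesgue_outer R n.+1) _ _)).
  rewrite [X in (X + _)%E](_ : _ = 0%E) ?[X in (_ + X)%E](_ : _ = 0%E) ?adde0//.
    apply: lebesgue_outer_null_countable => -[i q].
    apply: right_isolated_ae; last exact: rat_dir0.
    by apply: closed_expansion; exact: convexV_rV_continuous.
  apply: lebesgue_outer_null_countable => -[q m].
  by apply: expansion_ae => //; exact: rat_dir0.
move=> x /not_orP[nN1 nN2]; apply: convex_twice_differentiable_at => //.
  by move=> q m; apply: contrapT => H; apply: nN1; exists (q, m).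
move=> q q' m k j E e e0; apply: contrapT => H; apply: nN2.
exists (q', m, k, j, q) => //; split=> //=; exists e => // s se Es.
by apply: H; exists s.
Qed.

Lemma aleksandrov (d : nat) (g h : 'rV[R]_d -> R) : convexV g -> convexV h ->
  \forall x \ae lebesgue_measure_rV R d,
    twice_differentiable_at (fun y => g y - h y) x.
Proof.
move=> /aleksandrov_null[N N0 NP] /aleksandrov_null[N' N'0 N'P].
apply: (@ae_of_null _ _ (N `|` N')).
  apply/eqP; rewrite eq_le lebesgue_outer_ge0 andbT.
  apply: (le_trans (outer_measureU2 (lebesgue_outer R d) _ _)).
  by rewrite [X in (X + _)%E]N0 [X in (_ + X)%E]N'0 adde0.
by move=> x /not_orP[/NP ? /N'P ?]; exact: twice_differentiable_atB.
Qed.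

Lemma DC_lipschitz (d : nat) (g h : 'rV[R]_d -> R) (A : set 'rV[R]_d) :
  convexV g -> convexV h -> bounded_set A ->
  [lipschitz (g x - h x : R^o) | x in A].
Proof.
move=> cg ch [M [_ MA]].
have AM x : A x -> `|x| <= M + 1 by apply: MA; rewrite ltrDl.
have [L [L0 gL]] := convexV_rV_lipschitz (M + 1) cg.
have [L' [L'0 hL]] := convexV_rV_lipschitz (M + 1) ch.
exists (L + L'); split; first exact: num_real.
move=> k kL -[x y] [/= Ax Ay].
have := gL x y (AM x Ax) (AM y Ay); have := hL x y (AM x Ax) (AM y Ay).
have -> : g x - h x - (g y - h y) = (g x - g y) - (h x - h y) by lra.
move=> h1 h2; apply: (le_trans (ler_normB _ _)).
have : (L + L') * `|x - y| <= k * `|x - y| by rewrite ler_wpM2r// ltW.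
by lra.
Qed.

Lemma mx_convex_form (d l : nat) (F : 'rV[R]_d -> 'M[R]_l) (v : 'rV[R]_l) :
  mx_convex F -> convexV (fun x => (v *m F x *m v^T) ord0 ord0).
Proof.
move=> cF x y t t01; have [_ /(_ v)] := cF x y t t01.
have QB (A B : 'M[R]_l) : (v *m (A - B) *m v^T) ord0 ord0 =
    (v *m A *m v^T) ord0 ord0 - (v *m B *m v^T) ord0 ord0.
  rewrite mulmxBr mulmxBl; move: (v *m A *m _) (v *m B *m _) => X Y.
  by rewrite !mxE.
have QD (A B : 'M[R]_l) : (v *m (A + B) *m v^T) ord0 ord0 =
    (v *m A *m v^T) ord0 ord0 + (v *m B *m v^T) ord0 ord0.
  by rewrite mulmxDr mulmxDl mxE.
have QZ a (A : 'M[R]_l) : (v *m (a *: A) *m v^T) ord0 ord0 =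
    a * (v *m A *m v^T) ord0 ord0.
  by rewrite -scalemxAr -scalemxAl mxE.
by rewrite QB QD !QZ subr_ge0.
Qed.

End Aleksandrov.

Lemma mx_form_delta (R : realType) (l : nat) (A : 'M[R]_l) i j :
  ((delta_mx ord0 i : 'rV[R]_l) *m A *m (delta_mx ord0 j : 'rV[R]_l)^T) ord0 ord0 = A i j.
Proof. by rewrite -rowE trmx_delta -colE !mxE. Qed.

Lemma mx_form_delta_sum (R : realType) (l : nat) (A : 'M[R]_l) i j :
  let u := (delta_mx ord0 i + delta_mx ord0 j : 'rV[R]_l) in
  (u *m A *m u^T) ord0 ord0 = A i i + A i j + A j i + A j j.
Proof.
move=> u; rewrite /u linearD/= mulmxDl mulmxDl !mulmxDr.
rewrite -(mx_form_delta A i i) -(mx_form_delta A i j) -(mx_form_delta A j i) -(mx_form_delta A j j).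
move: (_ *m _ *m _) (_ *m _ *m _) (_ *m _ *m _) (_ *m _ *m _) => X Y Z W.
by rewrite !mxE addrA.
Qed.

Theorem theorem2 (R : realType) (d l : nat) (F : 'rV[R]_d -> 'M[R]_l)
    (F_sym : forall x, F x \is symmetricmx) (F_convex : mx_convex F)
    (i j : 'I_l) (neq_ij : i != j) :
  [/\ is_DC (fun x => F x i j),
      (forall A : set 'rV[R]_d, bounded_set A ->
         [lipschitz (F x i j : R^o) | x in A])
    & \forall x \ae lebesgue_measure_rV R d,
        twice_differentiable_at (fun y => F y i j) x].
Proof.
pose u : 'rV[R]_l := delta_mx ord0 i + delta_mx ord0 j.
pose g x : R := 2^-1 * (u *m F x *m u^T) ord0 ord0.
pose h x : R := 2^-1 * (F x i i + F x j j).
have cdiag k : convexV (fun x => F x k k).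
  have := mx_convex_form (delta_mx ord0 k) F_convex.
  by under eq_fun do rewrite mx_form_delta.
have cg : convexV g.
  move=> x y t t01; rewrite /g.
  have := mx_convex_form u F_convex x y t01.
  by move: (_ ord0 ord0) (_ ord0 ord0) (_ ord0 ord0) => a b c; lra.
have ch : convexV h.
  move=> x y t t01; rewrite /h; have := cdiag i x y t t01; have := cdiag j x y t t01.
  by move: (F _ i i) (F _ i i) (F _ i i) (F _ j j) (F _ j j) (F _ j j) => *; lra.
have FE : (fun x => F x i j) = (fun x => g x - h x).
  apply/funext => x; rewrite /g /h mx_form_delta_sum.
  (* Symmetry merges the two off-diagonal terms of the form, whence the factor 1/2. *)
  have Fji : F x j i = F x i j.
    by have := F_sym x; rewrite qualifE/= expr0 scale1r => /eqP {1}->; rewrite !mxE.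
  by rewrite Fji; lra.
split.
- exists g, h; split; [exact/convexVP|exact/convexVP|].
  by move=> x; have /(congr1 (fun f => f x)) := FE.
- by move=> A bA; rewrite FE; exact: DC_lipschitz.
- by rewrite FE; exact: aleksandrov.
Qed.
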